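(* Let $s=\sigma+it$ with $\sigma>1$ and $t>0$, let $\alpha\ge 0$, and let $c$ be a real number with $\max(-\sigma,\,1-2\sigma)<c<-1$. Then $$|\zeta_1(s,\alpha)|^2=\zeta_1(2\sigma,\alpha)+\frac{1}{2\pi i}\int_{(c)}\left(\frac{\Gamma(s+z)}{\Gamma(s)}+\frac{\Gamma(\bar s+z)}{\Gamma(\bar s)}\right)\Gamma(-z)\,\zeta(-z)\,\zeta_1(2\sigma+z,\alpha)\,dz .$$
   Context: $\zeta$ is the Riemann zeta function and $\Gamma$ the Gamma function. The modified Hurwitz zeta function is $\zeta_1(s,\alpha)=\sum_{n=1}^\infty (n+\alpha)^{-s}$ for $\Re s>1$, and by analytic continuation for other $s\neq 1$. The symbol $(c)$ denotes the vertical line $\Re z=c$ in the complex $z$-plane, traversed upwards from $c-i\infty$ to $c+i\infty$. *)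

(* Defs.v *)
From mathcomp Require Export all_boot all_order all_algebra.
From mathcomp Require Export complex.
From mathcomp Require Export all_classical all_reals all_analysis.

Set Implicit Arguments.
Unset Strict Implicit.
Unset Printing Implicit Defensive.

Export Order.TTheory GRing.Theory Num.Theory.
Export numFieldNormedType.Exports.

Local Open Scope classical_set_scope.
Local Open Scope ring_scope.
Local Open Scope complex_scope.

Definition cexp (R : realType) (z : R[i]) : R[i] :=
  (expR (complex.Re z))%:C * (cos (complex.Im z) +i* sin (complex.Im z)).

(* Principal value of [x ^ z] for a positive real base; [ln x] is a junk value
   for [x <= 0]. *)
Definition cpow (R : realType) (x : R) (z : R[i]) : R[i] :=
  cexp (z * (ln x)%:C).

(* [Rintegral] is a junk value on functions that are not integrable, so uses of
   [cintegral] are to be paired with [cintegrable]. *)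
Definition cintegrable (R : realType) (D : set R) (f : R -> R[i]) : Prop :=
  (@lebesgue_measure R).-integrable D (EFin \o (fun x => complex.Re (f x))) /\
  (@lebesgue_measure R).-integrable D (EFin \o (fun x => complex.Im (f x))).

Definition cintegral (R : realType) (D : set R) (f : R -> R[i]) : R[i] :=
  (\int[@lebesgue_measure R]_(x in D) complex.Re (f x)) +i*
  (\int[@lebesgue_measure R]_(x in D) complex.Im (f x)).

(* The line [Re z = c] is parametrised by [y |-> c + i y], so [dz = i dy]. *)
Definition vline_integrable (R : realType) (c : R) (f : R[i] -> R[i]) : Prop :=
  cintegrable setT (fun y => f (c +i* y)).

Definition vline_integral (R : realType) (c : R) (f : R[i] -> R[i]) : R[i] :=
  'i%C * cintegral setT (fun y => f (c +i* y)).

(* [R[i]^o] is [R[i]] seen as a normed module over itself, so this is complex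
   differentiability. *)
Definition holomorphic_on (R : realType) (U : set R[i]) (f : R[i] -> R[i]) :
    Prop :=
  forall z, U z -> derivable (f : R[i]^o -> R[i]^o) z 1.

(* The function [f], given on [D], continued analytically to [U].  The chosen
   [g] is unique on [U] when [U] is a connected open set and [D] is a nonempty
   open subset of [U]; the values outside [U] are arbitrary. *)
Definition continuation (R : realType) (D U : set R[i]) (f : R[i] -> R[i])
    (z : R[i]) : R[i] :=
  if z \in D then f z
  else xget f [set g | holomorphic_on U g /\ (forall w, D w -> g w = f w)] z.

Definition Gamma (R : realType) : R[i] -> R[i] :=
  continuation [set z | 0 < complex.Re z] [set z | forall n : nat, z != - n%:R]
    (fun z => cintegral `]0, +oo[ (fun x => cpow x (z - 1) * (expR (- x))%:C)).

Definition zeta (R : realType) : R[i] -> R[i] :=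
  continuation [set s | 1 < complex.Re s] [set s | s != 1]
    (fun s => limn (fun N => \sum_(1 <= n < N) (cpow n%:R (- s) : R[i]^o))).

Definition hurwitz1 (R : realType) (s : R[i]) (alpha : R) : R[i] :=
  continuation [set w | 1 < complex.Re w] [set w | w != 1]
    (fun w => limn (fun N =>
       \sum_(1 <= n < N) (cpow (n%:R + alpha) (- w) : R[i]^o))) s.

(* Main.v *)
Require Import Defs.
From mathcomp Require Import ring lra measurable_realfun.

(** Under the hypotheses every argument on the line [Re z = c] lies in the
    half-plane where Gamma, zeta and the Hurwitz zeta function are given by
    their integral or series, so no analytic continuation is involved.

    The substitution [x = e^u] turns [Gamma (a + i y)] into the Fourier transform
    of [u |-> exp (a u - e^u)].  Inverting it (Abel summation with the weight
    [e^(-eps |y|)], whose transform is the Poisson kernel) expresses [e^(-X)] as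
    an integral of [Gamma (- z) X^z]; integrating against [v^(s-1) e^(-v)] gives
    the Mellin-Barnes formula
      [2 pi Gamma s (1 + X)^(-s) = \int Gamma (s + z) Gamma (- z) X^z dy].
    With [X = j / (k + alpha)] this separates the off-diagonal terms
    [(k + j + alpha)^(-s) (k + alpha)^(-conj s)] of [|zeta_1 (s, alpha)|^2] into
    powers of [j] and of [k + alpha], which sum under the integral sign to
    [zeta (- z) zeta_1 (2 sigma + z, alpha)].

    Dividing by [Gamma s] requires [Gamma s != 0].  By the functional equation it
    is enough to treat a large real part [N], where the probability density
    proportional to [exp (N u - e^u)] is so concentrated near [u = ln N] that its
    characteristic function cannot vanish at [t]. *)

Local Open Scope classical_set_scope.
Local Open Scope ring_scope.
Local Open Scope complex_scope.

Set Implicit Arguments.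
Unset Strict Implicit.
Unset Printing Implicit Defensive.

Local Notation Re := (@complex.Re _).
Local Notation Im := (@complex.Im _).
Local Notation normc := ComplexField.Normc.normc.

(** * Complex-valued integrals *)

Section complex_facts.
Context {R : realType}.
Implicit Types (x y : R) (z w : R[i]).

Lemma ReD z w : Re (z + w) = Re z + Re w. Proof. by case: z w => [a b] []. Qed.
Lemma ImD z w : Im (z + w) = Im z + Im w. Proof. by case: z w => [a b] []. Qed.
Lemma ReN z : Re (- z) = - Re z. Proof. by case: z. Qed.
Lemma ImN z : Im (- z) = - Im z. Proof. by case: z. Qed.
Lemma ReM z w : Re (z * w) = Re z * Re w - Im z * Im w.
Proof. by case: z w => [a b] []. Qed.
Lemma ImM z w : Im (z * w) = Re z * Im w + Im z * Re w.
Proof. by case: z w => [a b] []. Qed.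

Lemma Re_sum (I : Type) (r : seq I) (P : pred I) (F : I -> R[i]) :
  Re (\sum_(i <- r | P i) F i) = \sum_(i <- r | P i) Re (F i).
Proof. by apply: (big_morph _ ReD). Qed.

Lemma Im_sum (I : Type) (r : seq I) (P : pred I) (F : I -> R[i]) :
  Im (\sum_(i <- r | P i) F i) = \sum_(i <- r | P i) Im (F i).
Proof. by apply: (big_morph _ ImD). Qed.

Lemma complex_ext z w : Re z = Re w -> Im z = Im w -> z = w.
Proof. by case: z w => [a b] [c d] /= -> ->. Qed.

Lemma normc_ge0 z : 0 <= normc z.
Proof. by case: z => a b; exact: sqrtr_ge0. Qed.

Lemma ler_Re_normc z : `|Re z| <= normc z.
Proof.
by case: z => a b /=; rewrite -sqrtr_sqr ler_wsqrtr// lerDl sqr_ge0.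
Qed.

Lemma ler_Im_normc z : `|Im z| <= normc z.
Proof.
by case: z => a b /=; rewrite -sqrtr_sqr ler_wsqrtr// lerDr sqr_ge0.
Qed.

Lemma normc_le z : normc z <= `|Re z| + `|Im z|.
Proof.
case: z => a b /=; rewrite -[leRHS]ger0_norm ?addr_ge0// -sqrtr_sqr ler_wsqrtr//.
rewrite sqrrD !real_normK ?num_real// -addrA lerD2l lerDr.
by rewrite mulrn_wge0// mulr_ge0.
Qed.

Lemma normc_real x : normc x%:C = `|x|.
Proof. by rewrite /= expr0n /= addr0 sqrtr_sqr. Qed.

Lemma normcM z w : normc (z * w) = normc z * normc w.
Proof. exact: ComplexField.Normc.normcM. Qed.

Lemma normc_conj z : normc (conjc z) = normc z.
Proof. by case: z => a b /=; rewrite sqrrN. Qed.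

Lemma normc_sum (I : Type) (r : seq I) (P : pred I) (F : I -> R[i]) :
  normc (\sum_(i <- r | P i) F i) <= \sum_(i <- r | P i) normc (F i).
Proof.
elim/big_rec2: _ => [|i y x _ h]; first by rewrite ComplexField.Normc.normc0.
by rewrite (le_trans (le_normcD _ _))// lerD2l.
Qed.

Lemma cexpD z w : cexp (z + w) = cexp z * cexp w.
Proof.
rewrite /cexp ReD ImD expRD cosD sinD.
by apply: complex_ext; rewrite !(ReM, ImM, ReD, ImD) /=; ring.
Qed.

Lemma normc_cexp z : normc (cexp z) = expR (Re z).
Proof.
by rewrite /cexp normcM normc_real /= cos2Dsin2 sqrtr1 mulr1 ger0_norm ?expR_ge0.
Qed.

Lemma cexp_conj z : cexp (conjc z) = conjc (cexp z).
Proof.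
case: z => a b; rewrite /cexp /= cosN sinN.
by apply: complex_ext; rewrite /=; ring.
Qed.

End complex_facts.

(** * Measurability of complex-valued functions *)

Section cmeasurable.
Context {d} {T : measurableType d} {R : realType}.
Implicit Types (f g : T -> R[i]).

(** Componentwise, to match the definition of [cintegrable]. *)
Definition cmeasurable f :=
  measurable_fun setT (Re \o f) /\ measurable_fun setT (Im \o f).

Lemma cmeasurable_cst (z : R[i]) : cmeasurable (fun=> z).
Proof. by split; exact: measurable_cst. Qed.

Lemma cmeasurable_real (h : T -> R) :
  measurable_fun setT h -> cmeasurable (fun x => (h x)%:C).
Proof. by split => //; exact: measurable_cst. Qed.

Lemma cmeasurable_pair (h k : T -> R) :
  measurable_fun setT h -> measurable_fun setT k ->
  cmeasurable (fun x => h x +i* k x).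
Proof. by split. Qed.

Lemma cmeasurableD f g : cmeasurable f -> cmeasurable g ->
  cmeasurable (fun x => f x + g x).
Proof.
move=> [fr fi] [gr gi]; split.
- rewrite (_ : _ \o _ = (Re \o f) \+ (Re \o g)); first exact: measurable_funD.
  by apply/funext => x /=; rewrite ReD.
- rewrite (_ : _ \o _ = (Im \o f) \+ (Im \o g)); first exact: measurable_funD.
  by apply/funext => x /=; rewrite ImD.
Qed.

Lemma cmeasurableM f g : cmeasurable f -> cmeasurable g ->
  cmeasurable (fun x => f x * g x).
Proof.
move=> [fr fi] [gr gi]; split.
- rewrite (_ : _ \o _ =
    ((Re \o f) \* (Re \o g)) \- ((Im \o f) \* (Im \o g))).
    by apply: measurable_funB; exact: measurable_funM.
  by apply/funext => x /=; rewrite ReM.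
- rewrite (_ : _ \o _ =
    ((Re \o f) \* (Im \o g)) \+ ((Im \o f) \* (Re \o g))).
    by apply: measurable_funD; exact: measurable_funM.
  by apply/funext => x /=; rewrite ImM.
Qed.

Lemma cmeasurable_cexp f : cmeasurable f -> cmeasurable (fun x => cexp (f x)).
Proof.
move=> [fr fi]; apply: cmeasurableM.
  by apply: cmeasurable_real; apply: measurableT_comp => //; exact: measurable_expR.
by apply: cmeasurable_pair; apply: measurableT_comp => //;
  apply: continuous_measurable_fun; [exact: continuous_cos|exact: continuous_sin].
Qed.

Lemma cmeasurable_sum (I : Type) (r : seq I) (P : pred I) (F : I -> T -> R[i]) :
  (forall i, cmeasurable (F i)) ->
  cmeasurable (fun x => \sum_(i <- r | P i) F i x).
Proof.
move=> mF; elim: r => [|i r ih].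
  rewrite (_ : (fun _ => _) = fun=> 0); first exact: cmeasurable_cst.
  by apply/funext => x; rewrite big_nil.
case: (boolP (P i)) => Pi.
  rewrite (_ : (fun _ => _) = fun x => F i x + \sum_(i <- r | P i) F i x).
    exact: cmeasurableD.
  by apply/funext => x; rewrite big_cons Pi.
rewrite (_ : (fun _ => _) = fun x => \sum_(i <- r | P i) F i x)//.
by apply/funext => x; rewrite big_cons (negbTE Pi).
Qed.

End cmeasurable.

(** * Integration of complex-valued functions and dominated convergence *)

Section cintegral.
Context {R : realType}.
Local Notation mu := (@lebesgue_measure R).
Implicit Types (f g : R -> R[i]) (h : R -> R) (D : set R).

Definition rintegrable h := mu.-integrable setT (EFin \o h).

Lemma rintegrable_measurable h : rintegrable h -> measurable_fun setT h.
Proof. by move=> /measurable_int /measurable_EFinP. Qed.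

Lemma rintegrableD h k : rintegrable h -> rintegrable k ->
  rintegrable (fun x => h x + k x).
Proof.
move=> ih ik; rewrite /rintegrable.
by have := integrableD measurableT ih ik; apply: eq_integrable.
Qed.

Lemma rintegrableZ r h : rintegrable h -> rintegrable (fun x => r * h x).
Proof.
move=> ih; rewrite /rintegrable.
by have := integrableZl measurableT r ih; apply: eq_integrable.
Qed.

Lemma le_rintegrable h k : measurable_fun setT h ->
  (forall x, `|h x| <= k x) -> rintegrable k -> rintegrable h.
Proof.
move=> mh hk; apply: le_integrable => //; first exact/measurable_EFinP.
by move=> x _; rewrite /= lee_fin (le_trans (hk x))// ler_norm.
Qed.

Lemma cintegrable_cmeasurable f : cintegrable setT f -> cmeasurable f.
Proof. by move=> [fr fi]; split; exact: rintegrable_measurable. Qed.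

Lemma dominated_cintegrable f h : cmeasurable f ->
  (forall x, normc (f x) <= h x) -> rintegrable h -> cintegrable setT f.
Proof.
move=> [mr mi] fh ih; split; apply: (@le_rintegrable _ h) => // x.
- by rewrite (le_trans (ler_Re_normc _)).
- by rewrite (le_trans (ler_Im_normc _)).
Qed.

Lemma rintegrable_normc f : cintegrable setT f ->
  rintegrable (fun x => `|Re (f x)| + `|Im (f x)|).
Proof. by move=> [fr fi]; apply: rintegrableD; exact: integrable_norm. Qed.

Lemma cintegrableD f g : cintegrable setT f -> cintegrable setT g ->
  cintegrable setT (fun x => f x + g x).
Proof.
move=> [fr fi] [gr gi]; split.
- rewrite (_ : (fun _ => _) = fun x => Re (f x) + Re (g x)); first exact: rintegrableD.
  by apply/funext => x; rewrite ReD.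
- rewrite (_ : (fun _ => _) = fun x => Im (f x) + Im (g x)); first exact: rintegrableD.
  by apply/funext => x; rewrite ImD.
Qed.

Lemma cintegrableZ c f : cintegrable setT f -> cintegrable setT (fun x => c * f x).
Proof.
move=> fi; apply: (@dominated_cintegrable _
  (fun x => normc c * (`|Re (f x)| + `|Im (f x)|))).
- apply: cmeasurableM; [exact: cmeasurable_cst|exact: cintegrable_cmeasurable].
- by move=> x; rewrite normcM ler_wpM2l ?normc_ge0// normc_le.
- by apply: rintegrableZ; exact: rintegrable_normc.
Qed.

Lemma cintegrable_sum (I : Type) (r : seq I) (F : I -> R -> R[i]) :
  (forall i, cintegrable setT (F i)) ->
  cintegrable setT (fun x => \sum_(i <- r) F i x).
Proof.
move=> mF; elim: r => [|i r ih].
  rewrite (_ : (fun _ => _) = fun=> 0); last by apply/funext => x; rewrite big_nil.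
  by split; exact: integrable0.
rewrite (_ : (fun _ => _) = fun x => F i x + \sum_(i <- r) F i x).
  exact: cintegrableD.
by apply/funext => x; rewrite big_cons.
Qed.

Lemma cintegralD f g : cintegrable setT f -> cintegrable setT g ->
  cintegral setT (fun x => f x + g x) = cintegral setT f + cintegral setT g.
Proof.
move=> [fr fi] [gr gi]; apply: complex_ext => /=.
- by rewrite -RintegralD//; apply: eq_Rintegral => x _; rewrite ReD.
- by rewrite -RintegralD//; apply: eq_Rintegral => x _; rewrite ImD.
Qed.

Lemma cintegralZ c f : cintegrable setT f ->
  cintegral setT (fun x => c * f x) = c * cintegral setT f.
Proof.
move=> [fr fi]; apply: complex_ext; rewrite ?ReM ?ImM /=.
- rewrite -!RintegralZl// -RintegralB//; try exact: rintegrableZ.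
  by apply: eq_Rintegral => x _; rewrite ReM.
- rewrite -!RintegralZl// -RintegralD//; try exact: rintegrableZ.
  by apply: eq_Rintegral => x _; rewrite ImM.
Qed.

Lemma cintegral_sum (I : Type) (r : seq I) (F : I -> R -> R[i]) :
  (forall i, cintegrable setT (F i)) ->
  cintegral setT (fun x => \sum_(i <- r) F i x) =
  \sum_(i <- r) cintegral setT (F i).
Proof.
move=> mF; elim: r => [|i r ih].
  rewrite big_nil /cintegral.
  under eq_Rintegral do rewrite big_nil /=.
  under [in X in _ +i* X]eq_Rintegral do rewrite big_nil /=.
  by rewrite /Rintegral integral0.
rewrite big_cons -ih -cintegralD//; last exact: cintegrable_sum.
by congr cintegral; apply/funext => x; rewrite big_cons.
Qed.

(** The two components are bounded separately by the integral of [h], which costs the factor 2. *)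
Lemma normc_cintegral_le f h : cmeasurable f ->
  (forall x, normc (f x) <= h x) -> rintegrable h ->
  normc (cintegral setT f) <= 2 * \int[mu]_x h x.
Proof.
move=> mf fh ih; have [fr fi] := dominated_cintegrable mf fh ih.
rewrite (le_trans (normc_le _))// mulrDl mul1r lerD//=.
- rewrite (le_trans (le_normr_Rintegral _ fr))//; apply: le_Rintegral => //.
  + exact: integrable_norm.
  + by move=> x _; rewrite (le_trans (ler_Re_normc _)).
- rewrite (le_trans (le_normr_Rintegral _ fi))//; apply: le_Rintegral => //.
  + exact: integrable_norm.
  + by move=> x _; rewrite (le_trans (ler_Im_normc _)).
Qed.

(* Componentwise convergence; [ccvg_limn] relates it to the norm topology of
   [R[i]^o] in which [zeta] and [hurwitz1] are defined. *)
Definition ccvg (u : nat -> R[i]) (l : R[i]) :=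
  (Re (u n) @[n --> \oo] --> Re l) /\ (Im (u n) @[n --> \oo] --> Im l).

Lemma rdominated_convergence (u : nat -> R -> R) h (b : R -> R) :
  (forall n, measurable_fun setT (u n)) -> measurable_fun setT h ->
  (forall x, u n x @[n --> \oo] --> h x) ->
  (forall n x, `|u n x| <= b x) -> rintegrable b ->
  rintegrable h /\ (\int[mu]_x u n x @[n --> \oo] --> \int[mu]_x h x).
Proof.
move=> mu_ mh uh ub ib.
have [] := @dominated_convergence _ _ _ mu setT measurableT
  (fun n => EFin \o u n) (EFin \o h) (EFin \o b).
- by move=> n; apply/measurable_EFinP; exact: mu_.
- by apply/measurable_EFinP; exact: mh.
- by apply: aeW => x _; apply: cvg_EFin; [exact: nearW|exact: uh].
- exact: ib.
- by apply: aeW => x n _ /=; rewrite lee_fin.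
move=> ih _ cv; split => //.
have fh : (\int[mu]_x (h x)%:E)%E \is a fin_num := integrable_fin_num measurableT ih.
apply/fine_cvg; rewrite fineK//; exact: cv.
Qed.

(** Real dominated convergence for each component; the limit is measurable as a pointwise limit of
    measurable functions. *)
Lemma cdominated_convergence (u : nat -> R -> R[i]) f (b : R -> R) :
  (forall n, cmeasurable (u n)) ->
  (forall x, ccvg (u ^~ x) (f x)) ->
  (forall n x, normc (u n x) <= b x) -> rintegrable b ->
  cintegrable setT f /\
  ccvg (fun n => cintegral setT (u n)) (cintegral setT f).
Proof.
move=> mu_ uf ub ib.
have mr : measurable_fun setT (fun x => Re (f x)).
  apply: (@measurable_fun_cvg _ _ _ _ (fun n x => Re (u n x))) => [n|x _].
    by have [] := mu_ n.
  by have [] := uf x.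
have mi : measurable_fun setT (fun x => Im (f x)).
  apply: (@measurable_fun_cvg _ _ _ _ (fun n x => Im (u n x))) => [n|x _].
    by have [] := mu_ n.
  by have [] := uf x.
have [ir cr] := @rdominated_convergence (fun n x => Re (u n x)) _ b
  (fun n => (mu_ n).1) mr (fun x => (uf x).1)
  (fun n x => le_trans (ler_Re_normc _) (ub n x)) ib.
have [ii ci] := @rdominated_convergence (fun n x => Im (u n x)) _ b
  (fun n => (mu_ n).2) mi (fun x => (uf x).2)
  (fun n x => le_trans (ler_Im_normc _) (ub n x)) ib.
by split; split.
Qed.

End cintegral.

(** * Change of variables on the real line *)

Section real_derivatives.
Context {R : realType}.
Implicit Types (f g : R -> R) (x a b : R).

Lemma is_derive_fun_cst x a : is_derive x (1 : R) (fun=> a) 0.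
Proof. exact: is_derive_cst. Qed.

Lemma is_derive_fun_id x : is_derive x (1 : R) (fun y => y) 1.
Proof. exact: is_derive_id. Qed.

Lemma is_derive_funD f g x a b : is_derive x (1 : R) f a ->
  is_derive x (1 : R) g b -> is_derive x (1 : R) (fun y => f y + g y) (a + b).
Proof. exact: is_deriveD. Qed.

Lemma is_derive_funN f x a : is_derive x (1 : R) f a ->
  is_derive x (1 : R) (fun y => - f y) (- a).
Proof. exact: is_deriveN. Qed.

Lemma is_derive_funM f g x a b : is_derive x (1 : R) f a ->
  is_derive x (1 : R) g b ->
  is_derive x (1 : R) (fun y => f y * g y) (f x * b + g x * a).
Proof. exact: is_deriveM. Qed.

Lemma is_derive_fun_comp (h : R -> R) f x a b :
  is_derive (f x) (1 : R) h b -> is_derive x (1 : R) f a ->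
  is_derive x (1 : R) (fun y => h (f y)) (b * a).
Proof. exact: is_derive1_comp. Qed.

Lemma is_derive_fun_eq f x a b : is_derive x (1 : R) f a -> a = b ->
  is_derive x (1 : R) f b.
Proof. by move=> + <-. Qed.

Lemma is_derive_continuous f (f' : R -> R) :
  (forall x, is_derive x (1 : R) f (f' x)) -> continuous f.
Proof.
by move=> df x; apply/differentiable_continuous/derivable1_diffP; case: (df x).
Qed.

End real_derivatives.

(* [notypeclasses] keeps the instances of [is_derive] from solving the subgoals
   with derivatives in a different form. *)
Ltac derive_tac :=
  notypeclasses refine (is_derive_fun_eq _ _);
  [repeat first
    [ notypeclasses refine (is_derive_fun_cst _ _)
    | notypeclasses refine (is_derive_fun_id _)
    | notypeclasses refine (is_derive_funD _ _)
    | notypeclasses refine (is_derive_funN _)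
    | notypeclasses refine (is_derive_fun_comp (is_derive_expR _) _)
    | notypeclasses refine (is_derive_fun_comp (is_derive_cos _) _)
    | notypeclasses refine (is_derive_fun_comp (is_derive_sin _) _)
    | notypeclasses refine (is_derive_funM _ _) ]
  | rewrite /=].

Section change_of_variables.
Context {R : realType}.
Local Notation mu := (@lebesgue_measure R).
Implicit Types (h f F : R -> R) (a b : R).

(** Extends a substitution formula from nonnegative to integrable continuous integrands: applied to
    [|h|] it gives integrability, applied to the positive and negative parts it gives the value. *)
Lemma signed_change_of_variables (D : set R) (T w : R -> R) :
  measurable D -> measurable_fun D T -> measurable_fun D w ->
  (forall x, D x -> 0 <= w x) ->
  (forall h, continuous h -> (forall x, 0 <= h x) ->
    (\int[mu]_(x in D) (h (T x) * w x)%:E = \int[mu]_x (h x)%:E)%E) ->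
  forall h, continuous h -> rintegrable h ->
    mu.-integrable D (EFin \o (fun x => h (T x) * w x)) /\
    \int[mu]_(x in D) (h (T x) * w x) = \int[mu]_x h x.
Proof.
move=> mD mT mw w0 H.
have key h : continuous h -> rintegrable h ->
    mu.-integrable D (EFin \o (fun x => h (T x) * w x)).
  move=> ch ih; apply/integrableP; split.
    apply/measurable_EFinP; apply: measurable_funM => //.
    apply: measurableT_comp => //; exact: continuous_measurable_fun.
  have /integrableP[_] := ih; apply: le_lt_trans.
  rewrite [leRHS](_ : _ = (\int[mu]_x (`|h x|)%:E)%E)// -(H (fun x => `|h x|)).
  - rewrite le_eqVlt; apply/orP; left; apply/eqP; apply: eq_integral => x.
    by rewrite inE /= => Dx; rewrite normrM [`|w x|]ger0_norm ?w0.
  - by move=> x; apply: (cvg_norm (ch x)).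
  - by [].
move=> h ch ih; split; first exact: key.
(* Positive and negative parts, in a form that shows their continuity. *)
pose p x := 2^-1 * (`|h x| + h x); pose n x := 2^-1 * (`|h x| - h x).
have p0 x : 0 <= p x.
  by rewrite mulr_ge0// -lerBlDr sub0r -normrN ler_norm.
have n0 x : 0 <= n x by rewrite mulr_ge0// subr_ge0 ler_norm.
have pn x : p x + n x = `|h x| by rewrite /p /n; field.
have hpn x : h x = p x - n x by rewrite /p /n; field.
have cp : continuous p.
  move=> x; apply: cvgM; first exact: cvg_cst.
  by apply: cvgD; [apply: cvg_norm|]; exact: ch.
have cn : continuous n.
  move=> x; apply: cvgM; first exact: cvg_cst.
  by apply: cvgB; [apply: cvg_norm|]; exact: ch.
have ip : rintegrable p.
  apply: (@le_rintegrable _ _ (fun x => `|h x|)).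
  - exact: continuous_measurable_fun.
  - by move=> x; rewrite ger0_norm// -pn lerDl.
  - exact: integrable_norm.
have iN : rintegrable n.
  apply: (@le_rintegrable _ _ (fun x => `|h x|)).
  - exact: continuous_measurable_fun.
  - by move=> x; rewrite ger0_norm// -pn lerDr.
  - exact: integrable_norm.
have -> : \int[mu]_x h x = \int[mu]_x p x - \int[mu]_x n x.
  by rewrite -RintegralB//; apply: eq_Rintegral => x _; exact: hpn.
have -> : \int[mu]_(x in D) (h (T x) * w x) =
    \int[mu]_(x in D) (p (T x) * w x - n (T x) * w x).
  by apply: eq_Rintegral => x _; rewrite hpn mulrBl.
rewrite RintegralB//; [|exact: key|exact: key].
by rewrite /Rintegral !H.
Qed.

Lemma ge0_integral_affine a b h : 0 < a -> continuous h -> (forall x, 0 <= h x) ->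
  (\int[mu]_x (h (b + a * x) * a)%:E = \int[mu]_x (h x)%:E)%E.
Proof.
move=> a0 ch h0.
have dF (x : R) : is_derive x (1 : R) (fun y : R => b + a * y) a.
  by derive_tac; ring.
have F' : derive1 (fun x : R => b + a * x) = cst a.
  by apply/funext => x; rewrite derive1E derive_val.
rewrite (@increasing_ge0_integration_by_substitutionT _ (fun x => b + a * x) h).
- by apply: eq_integral => x _; rewrite F'.
- by move=> x y xy; rewrite ltrD2l ltr_pM2l.
- by rewrite F'; exact: cst_continuous.
- by rewrite F'; exact: is_cvg_cst.
- by rewrite F'; exact: is_cvg_cst.
- by [].
- apply/cvgrNyPle => A; exists ((A - b) / a); split; first exact: num_real.
  by move=> x /ltW; rewrite ler_pdivlMr// lerBrDl mulrC.
- apply/cvgryPge => A; exists ((A - b) / a); split; first exact: num_real.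
  by move=> x /ltW; rewrite ler_pdivrMr// lerBlDl mulrC.
- exact: ch.
- exact: h0.
Qed.

Lemma Rintegral_affine a b h : 0 < a -> continuous h -> rintegrable h ->
  rintegrable (fun x => h (b + a * x) * a) /\
  \int[mu]_x (h (b + a * x) * a) = \int[mu]_x h x.
Proof.
move=> a0; apply: (@signed_change_of_variables setT (fun x => b + a * x) (cst a)).
- exact: measurableT.
- by apply: measurable_funD => //; apply: measurable_funM.
- exact: measurable_cst.
- by move=> x _; exact: ltW.
- by move=> k; exact: ge0_integral_affine.
Qed.

Lemma Rintegral_shift b h : continuous h -> rintegrable h ->
  rintegrable (fun x => h (b + x)) /\
  \int[mu]_x (h (b + x)) = \int[mu]_x h x.
Proof.
move=> ch ih; have := @Rintegral_affine 1 b h ltr01 ch ih.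
by under [X in rintegrable X]eq_fun do rewrite mulr1 mul1r;
  under eq_Rintegral do rewrite mulr1 mul1r.
Qed.

Lemma nat_itv_bigcup : \bigcup_n `[- n%:R, n%:R]%classic = [set: R].
Proof.
apply/seteqP; split => // x _; exists (Num.bound `|x|) => //=.
by rewrite in_itv/= -ler_norml ltW// archi_boundP.
Qed.

Lemma expR_itv_bigcup :
  \bigcup_n `[expR (- n%:R), expR n%:R]%classic = `]0, +oo[%classic :> set R.
Proof.
apply/seteqP; split => [x [n _ /=]|x /=]; rewrite !in_itv/=.
  by move=> /andP[+ _]; rewrite andbT; apply: lt_le_trans; exact: expR_gt0.
rewrite andbT => x0; exists (Num.bound `|ln x|) => //=.
have := archi_boundP (normr_ge0 (ln x)); set n := Num.bound _ => /ltW.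
by rewrite in_itv/= ler_norml -[x in X in _ -> X]lnK// !ler_expR.
Qed.

Lemma nat_itv_nondecreasing (f : R -> R) : {homo f : x y / x <= y} ->
  nondecreasing_seq (fun n => `[f (- n%:R), f n%:R]%classic : set R).
Proof.
move=> hf m n mn; rewrite subsetEset => x /=; rewrite !in_itv/= => /andP[h1 h2].
by rewrite (le_trans _ h1) ?(le_trans h2)//; apply: hf; rewrite ?lerN2 ler_nat.
Qed.

(** Substitution [x = e^u] on a compact interval: the Jacobian [e^u] cancels the factor [x^-1]. *)
Lemma integral_ln_itv n h : continuous h ->
  (\int[mu]_(x in `[(expR (- n%:R))%R, (expR n%:R)%R]) (h (ln x) * x^-1)%:E =
   \int[mu]_(x in `[(- n%:R)%R, n%:R%R]) (h x)%:E)%E.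
Proof.
move=> ch.
have F' : derive1 (@expR R) = @expR R.
  by apply/funext => x; rewrite derive1E derive_val.
rewrite (@integration_by_substitution_increasing _ (@expR R)
  (fun x => h (ln x) * x^-1)).
- apply: eq_integral => x _; rewrite /= fctE F' /= expRK -mulrA mulVf ?mulr1//.
  by rewrite expR_eq0.
- by rewrite (@le_trans _ _ 0)// oppr_le0.
- by move=> x y _ _ xy; rewrite ltr_expR.
- by rewrite F' => x _; exact: continuous_expR.
- apply/cvg_ex; exists (expR (- n%:R)); rewrite F'.
  by apply: cvg_at_right_filter; exact: continuous_expR.
- apply/cvg_ex; exists (expR n%:R); rewrite F'.
  by apply: cvg_at_left_filter; exact: continuous_expR.
- split.
  + by move=> x _; exact: derivable_expR.
  + by apply: cvg_at_right_filter; exact: continuous_expR.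
  + by apply: cvg_at_left_filter; exact: continuous_expR.
- apply: continuous_in_subspaceT => x; rewrite inE /= in_itv/= => /andP[x0 _].
  have {}x0 : 0 < x by rewrite (lt_le_trans _ x0)// expR_gt0.
  apply: cvgM; last by apply: cvgV; [rewrite gt_eqF|exact: cvg_id].
  by apply: (@continuous_comp _ _ _ (@ln R) h); [exact: continuous_ln|exact: ch].
Qed.

Lemma measurable_inv_itv0y :
  measurable_fun (`]0, +oo[%classic : set R) (fun x : R => x^-1).
Proof.
apply: open_continuous_measurable_fun; first exact: interval_open.
move=> x; rewrite inE/= in_itv/= andbT => x0.
by apply: cvgV; [rewrite gt_eqF|exact: cvg_id].
Qed.

(** By monotone convergence along [[-n, n]] and along its image [[e^-n, e^n]], both sides are limits
    of the same sequence. *)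
Lemma ge0_integral_ln h : continuous h -> (forall x, 0 <= h x) ->
  (\int[mu]_(x in `]0%R, +oo[) (h (ln x) * x^-1)%:E = \int[mu]_x (h x)%:E)%E.
Proof.
move=> ch h0.
have mh : measurable_fun setT h by exact: continuous_measurable_fun.
have cvR : (\int[mu]_(x in `[(- n%:R)%R, n%:R%R]) (h x)%:E)%E @[n --> \oo] -->
    (\int[mu]_x (h x)%:E)%E.
  rewrite -nat_itv_bigcup; apply: ge0_nondecreasing_set_cvg_integral.
  - exact: (nat_itv_nondecreasing (fun _ _ => id)).
  - by move=> n; exact: measurable_itv.
  - by move=> n; apply/measurable_EFinP; exact: measurable_funTS.
  - by move=> n x _; rewrite lee_fin.
have mg : measurable_fun (`]0, +oo[%classic : set R) (fun x => h (ln x) * x^-1).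
  apply: measurable_funM; last exact: measurable_inv_itv0y.
  apply: measurable_funTS; apply: measurableT_comp => //; exact: measurable_ln.
have cv0 : (\int[mu]_(x in `[(expR (- n%:R))%R, (expR n%:R)%R])
      (h (ln x) * x^-1)%:E)%E @[n --> \oo] -->
    (\int[mu]_(x in `]0%R, +oo[) (h (ln x) * x^-1)%:E)%E.
  rewrite -expR_itv_bigcup; apply: ge0_nondecreasing_set_cvg_integral.
  - by apply: nat_itv_nondecreasing => x y; rewrite ler_expR.
  - by move=> n; exact: measurable_itv.
  - move=> n; apply/measurable_EFinP; apply: measurable_funS mg => //.
    by rewrite -expR_itv_bigcup => x xn; exists n.
  - move=> n x /=; rewrite in_itv/= => /andP[x0 _].
    by rewrite lee_fin mulr_ge0// invr_ge0 (le_trans _ x0)// expR_ge0.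
rewrite -(cvg_lim _ cvR)// -(cvg_lim _ cv0)//.
by congr (limn _); apply/funext => n; exact: integral_ln_itv.
Qed.

Lemma Rintegral_ln h : continuous h -> rintegrable h ->
  mu.-integrable `]0%R, +oo[ (EFin \o (fun x => h (ln x) * x^-1)) /\
  \int[mu]_(x in `]0%R, +oo[) (h (ln x) * x^-1) = \int[mu]_x h x.
Proof.
apply: signed_change_of_variables.
- exact: measurable_itv.
- by apply: measurable_funTS; exact: measurable_ln.
- exact: measurable_inv_itv0y.
- by move=> x /=; rewrite in_itv/= andbT invr_ge0 => /ltW.
- exact: ge0_integral_ln.
Qed.

(** Dominated convergence for the restrictions of [f] to [[-n, n]], which at each point are
    eventually constant in [n]. *)
Lemma cvg_integral_nat_itv f : rintegrable f ->
  \int[mu]_(x in `[- n%:R, n%:R]) f x @[n --> \oo] --> \int[mu]_x f x.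
Proof.
move=> fi; under eq_fun do rewrite Rintegral_mkcond.
have mf := rintegrable_measurable fi.
pose u n : R -> R := f \_ `[- n%:R, n%:R].
have mu_ n : measurable_fun setT (u n).
  by apply/(measurable_restrictT f) => //; apply: measurable_funTS.
have cu x : u n x @[n --> \oo] --> f x.
  apply: cvg_near_cst; exists (Num.bound `|x|) => //= n /= xn.
  rewrite /u patchE ifT// inE/= in_itv/= -ler_norml ltW//.
  by rewrite (lt_le_trans (archi_boundP (normr_ge0 x)))// ler_nat.
have uf n x : `|u n x| <= `|f x|.
  by rewrite /u patchE; case: ifP => // _; rewrite normr0.
by have [] := rdominated_convergence mu_ mf cu uf (integrable_norm fi).
Qed.

Lemma Rintegral_FTC2 f F a b : a < b -> continuous f ->
  (forall x, is_derive x (1 : R) F (f x)) ->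
  \int[mu]_(x in `[a, b]) f x = F b - F a.
Proof.
move=> ab cf dF; have cF := is_derive_continuous dF.
rewrite /Rintegral (@continuous_FTC2 _ f F)//.
- exact: continuous_subspaceT.
- split; first by move=> x _; case: (dF x).
  + by apply: cvg_at_right_filter; exact: cF.
  + by apply: cvg_at_left_filter; exact: cF.
- by move=> x _; rewrite derive1E; case: (dF x).
Qed.

(** The integral over [[-n, n]] is [F n - F (-n)], which tends to 0. This is integration by parts
    with vanishing boundary terms. *)
Lemma Rintegral_derive_eq0 f F : continuous f -> rintegrable f ->
  (forall x, is_derive x (1 : R) F (f x)) ->
  F n%:R @[n --> \oo] --> (0 : R) -> F (- n%:R) @[n --> \oo] --> (0 : R) ->
  \int[mu]_x f x = 0.
Proof.
move=> cf fi dF Fy FNy.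
have h : \int[mu]_(x in `[- n%:R, n%:R]) f x @[n --> \oo] --> (0 : R).
  have h0 : F n%:R - F (- n%:R) @[n --> \oo] --> (0 : R).
    by rewrite -[X in _ --> X]subr0; exact: cvgB.
  (* The fundamental theorem is applied on a nondegenerate interval, so [n = 0] is left out. *)
  apply: (cvg_trans (near_eq_cvg _) h0); near=> n.
  rewrite (@Rintegral_FTC2 f F)// gtrN// ltr0n; near: n.
  by exists 1%N.
exact: (cvg_unique (@Rhausdorff R) (cvg_integral_nat_itv fi) h).
Unshelve. all: by end_near. Qed.

End change_of_variables.

(** * Fubini's theorem *)

Section fubini.
Context {R : realType}.
Local Notation mu := (@lebesgue_measure R).
Implicit Types (a b : R -> R).

Lemma rintegrable_section (H : R -> R -> R) a b x :
  measurable_fun [set: R * R] (fun p => H p.1 p.2) ->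
  (forall x y, `|H x y| <= a x * b y) -> rintegrable b ->
  rintegrable (H x).
Proof.
move=> mH Hab ib; apply: (@le_rintegrable _ _ (fun y => a x * b y)) => //.
- exact: (measurableT_comp mH (pair1_measurable x)).
- exact: rintegrableZ.
Qed.

(** A product majorant [a x * b y] bounds the iterated integral of [|H|] by the product of the
    integrals of [a] and [b], so [H] is integrable on the plane. *)
Lemma rFubini (H : R -> R -> R) a b :
  measurable_fun [set: R * R] (fun p => H p.1 p.2) ->
  (forall x y, `|H x y| <= a x * b y) -> rintegrable a -> rintegrable b ->
  \int[mu]_x (\int[mu]_y H x y) = \int[mu]_y (\int[mu]_x H x y).
Proof.
move=> mH Hab ia ib.
have i1 x : rintegrable (H x) by exact: (rintegrable_section _ mH Hab ib).
have i2 y : rintegrable (H ^~ y).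
  apply: (@le_rintegrable _ _ (fun x => b y * a x)) => //.
  - exact: (measurableT_comp mH (pair2_measurable y)).
  - by move=> x; rewrite mulrC.
  - exact: rintegrableZ.
have mE : measurable_fun [set: R * R] (EFin \o (fun p => H p.1 p.2)).
  exact/measurable_EFinP.
have iH : (mu \x mu)%E.-integrable setT (EFin \o (fun p => H p.1 p.2)).
  apply/integrable12ltyP => //=.
  apply: (@le_lt_trans _ _ (\int[mu]_x (a x * \int[mu]_y b y)%:E)%E).
    apply: ge0_le_integral => //.
    - by move=> x _; apply: integral_ge0.
    - have mA : measurable_fun [set: R * R] (fun p => `|(H p.1 p.2)%:E|%E).
        exact: measurableT_comp.
      exact: (@measurable_fun_fubini_tonelli_F _ _ _ _ _ mu _ mA).
    - apply/measurable_EFinP; apply: measurable_funM => //.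
      exact: rintegrable_measurable.
    - move=> x _.
      have -> : (a x * \int[mu]_y b y)%:E = (\int[mu]_y (a x * b y)%:E)%E.
        rewrite -RintegralZl// /Rintegral fineK//.
        by apply: integrable_fin_num => //; exact: rintegrableZ.
      apply: ge0_le_integral => //.
      + apply/measurable_EFinP; apply: measurableT_comp => //.
        exact: rintegrable_measurable (i1 x).
      + apply/measurable_EFinP.
        exact: (rintegrable_measurable (rintegrableZ (a x) ib)).
      + by move=> y _; rewrite lee_fin.
  have : rintegrable (fun x => a x * \int[mu]_y b y).
    rewrite (_ : (fun _ => _) = fun x => (\int[mu]_y b y) * a x).
      exact: rintegrableZ.
    by apply/funext => x; rewrite mulrC.
  exact: integrable_lty.
rewrite /Rintegral; congr fine.
transitivity (\int[mu]_x \int[mu]_y (H x y)%:E)%E.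
  apply: eq_integral => x _.
  by rewrite fineK//; exact: (integrable_fin_num measurableT (i1 x)).
rewrite (Fubini iH); apply: eq_integral => y _.
by rewrite fineK//; exact: (integrable_fin_num measurableT (i2 y)).
Qed.

Lemma cFubini (H : R -> R -> R[i]) a b :
  cmeasurable (fun p : R * R => H p.1 p.2) ->
  (forall x y, normc (H x y) <= a x * b y) -> rintegrable a -> rintegrable b ->
  cintegral setT (fun x => cintegral setT (H x)) =
  cintegral setT (fun y => cintegral setT (H ^~ y)).
Proof.
move=> [mr mi] Hab ia ib; apply: complex_ext => /=.
- apply: (@rFubini (fun x y => Re (H x y)) a b) => // x y.
  by rewrite (le_trans (ler_Re_normc _)).
- apply: (@rFubini (fun x y => Im (H x y)) a b) => // x y.
  by rewrite (le_trans (ler_Im_normc _)).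
Qed.

(** The multiplication formula for Fourier transforms, with any measurable kernel of modulus at most
    1. It serves both Fourier inversion and the Mellin-Barnes formula. *)
Lemma fourier_exchange (f g : R -> R[i]) (K : R -> R -> R[i]) :
  cintegrable setT f -> cintegrable setT g ->
  cmeasurable (fun p : R * R => K p.1 p.2) ->
  (forall x y, normc (K x y) <= 1) ->
  cintegral setT (fun x => f x * cintegral setT (fun y => K x y * g y)) =
  cintegral setT (fun y => cintegral setT (fun x => f x * K x y) * g y).
Proof.
move=> fi gi mK K1.
have mf := cintegrable_cmeasurable fi; have mg := cintegrable_cmeasurable gi.
have mK1 x : cmeasurable (K x).
  by case: mK => r i; split; [exact: (measurableT_comp r (pair1_measurable x))|
    exact: (measurableT_comp i (pair1_measurable x))].
have mK2 y : cmeasurable (K ^~ y).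
  by case: mK => r i; split; [exact: (measurableT_comp r (pair2_measurable y))|
    exact: (measurableT_comp i (pair2_measurable y))].
pose a x := `|Re (f x)| + `|Im (f x)|; pose b x := `|Re (g x)| + `|Im (g x)|.
have ia : rintegrable a by exact: rintegrable_normc.
have ib : rintegrable b by exact: rintegrable_normc.
have fa x : normc (f x) <= a x by exact: normc_le.
have gb x : normc (g x) <= b x by exact: normc_le.
have i1 x : cintegrable setT (fun y => K x y * g y).
  apply: (dominated_cintegrable (h := b)) => //; first exact: cmeasurableM.
  by move=> y; rewrite normcM -[b y]mul1r ler_pM ?normc_ge0.
have i2 y : cintegrable setT (fun x => f x * K x y).
  apply: (dominated_cintegrable (h := a)) => //; first exact: cmeasurableM.
  by move=> x; rewrite normcM -[a x]mulr1 ler_pM ?normc_ge0.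
transitivity (cintegral setT (fun x => cintegral setT (fun y => f x * (K x y * g y)))).
  by congr cintegral; apply/funext => x; rewrite cintegralZ.
rewrite (@cFubini _ a b)//.
  congr cintegral; apply/funext => y; rewrite mulrC -cintegralZ//.
  by congr cintegral; apply/funext => x; rewrite mulrA mulrC.
- apply: cmeasurableM; last apply: cmeasurableM => //.
  + by case: mf => r i; split; [exact: (measurableT_comp r measurable_fst)|
      exact: (measurableT_comp i measurable_fst)].
  + by case: mg => r i; split; [exact: (measurableT_comp r measurable_snd)|
      exact: (measurableT_comp i measurable_snd)].
- move=> x y; rewrite !normcM ler_pM ?normc_ge0 ?mulr_ge0 ?normc_ge0//.
  by rewrite -[b y]mul1r ler_pM ?normc_ge0.
Qed.

End fubini.

(** * The integrable majorant [1 / (1 + x^2)] *)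

Section dominating_function.
Context {R : realType}.
Local Notation mu := (@lebesgue_measure R).
Implicit Types (x y e : R).

Lemma oneDsqr_gt0 x : 0 < oneDsqr x.
Proof. by rewrite (lt_le_trans _ (oneDsqr_ge1 x)). Qed.

Lemma integral_oneDsqrV : (\int[mu]_x ((oneDsqr x)^-1)%:E = (pi : R)%:E)%E.
Proof.
rewrite ge0_symfun_integralT.
- rewrite -set_itvcy integral0y_oneDsqr -EFinM; congr EFin.
  by rewrite mulrCA divff ?mulr1// pnatr_eq0.
- by move=> x; rewrite invr_ge0 ltW ?oneDsqr_gt0.
- exact: continuous_oneDsqrV.
- by move=> x; rewrite /= /oneDsqr sqrrN.
Qed.

Lemma rintegrable_oneDsqrV : rintegrable (fun x : R => (oneDsqr x)^-1).
Proof.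
apply/integrableP; split.
  apply/measurable_EFinP; apply: continuous_measurable_fun.
  exact: continuous_oneDsqrV.
under eq_integral do rewrite /= ger0_norm ?invr_ge0 ?ltW ?oneDsqr_gt0//.
by rewrite integral_oneDsqrV ltry.
Qed.

Lemma Rintegral_oneDsqrV : \int[mu]_x (oneDsqr x)^-1 = pi :> R.
Proof. by rewrite /Rintegral integral_oneDsqrV. Qed.

(** The exponential of [y = e * |x|] is at least [1 + y^2 / 2], and [m] lies below both coefficients
    of this quadratic in [x]. *)
Lemma expR_norm_le e : 0 < e -> exists C : R, forall x,
  expR (- (e * `|x|)) <= C * (oneDsqr x)^-1.
Proof.
move=> e0; pose m := Num.min 1 (e ^+ 2 / 2); exists m^-1 => x.
have m0 : 0 < m by rewrite lt_min ltr01/= divr_gt0// exprn_gt0.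
rewrite expRN -invfM lef_pV2 ?posrE ?expR_gt0 ?mulr_gt0 ?oneDsqr_gt0//.
apply: le_trans (@expR_ge1Dxn R (e * `|x|) 1 (mulr_ge0 (ltW e0) (normr_ge0 x))).
rewrite /oneDsqr mulrDr mulr1 lerD//.
  by rewrite /m ge_min lexx.
rewrite exprMn real_normK ?num_real// mulrAC ler_wpM2r ?sqr_ge0//.
by rewrite /m ge_min lexx orbT.
Qed.

Lemma rintegrable_expR_norm e : 0 < e ->
  rintegrable (fun x => expR (- (e * `|x|))).
Proof.
move=> e0; have [C hC] := expR_norm_le e0.
apply: (@le_rintegrable _ _ (fun x => C * (oneDsqr x)^-1)).
- apply: measurableT_comp; first exact: measurable_expR.
  by apply: measurableT_comp => //; apply: measurable_funM.
- by move=> x; rewrite ger0_norm ?expR_ge0.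
- by apply: rintegrableZ; exact: rintegrable_oneDsqrV.
Qed.

End dominating_function.

(** * Fourier inversion *)

Section fourier.
Context {R : realType}.
Local Notation mu := (@lebesgue_measure R).
Implicit Types (x y e : R) (f g : R -> R).

Lemma ccvg_unique (u : nat -> R[i]) l l' : ccvg u l -> ccvg u l' -> l = l'.
Proof.
move=> [r i] [r' i']; apply: complex_ext.
- exact: (cvg_unique (@Rhausdorff R) r r').
- exact: (cvg_unique (@Rhausdorff R) i i').
Qed.

Lemma ccvg_real (u : nat -> R) (l : R) :
  u n @[n --> \oo] --> l -> ccvg (fun n => (u n)%:C) l%:C.
Proof. by split => //=; exact: cvg_cst. Qed.

Lemma ccvg_cst (z : R[i]) : ccvg (fun=> z) z.
Proof. by split; exact: cvg_cst. Qed.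

Lemma ccvgD (u v : nat -> R[i]) l m : ccvg u l -> ccvg v m ->
  ccvg (fun n => u n + v n) (l + m).
Proof.
move=> [ur ui] [vr vi]; split; rewrite ?ReD ?ImD.
- by under eq_fun do rewrite ReD; exact: cvgD.
- by under eq_fun do rewrite ImD; exact: cvgD.
Qed.

Lemma ccvgM (u v : nat -> R[i]) l m : ccvg u l -> ccvg v m ->
  ccvg (fun n => u n * v n) (l * m).
Proof.
move=> [ur ui] [vr vi]; split; rewrite ?ReM ?ImM.
- by under eq_fun do rewrite ReM; apply: cvgB; exact: cvgM.
- by under eq_fun do rewrite ImM; apply: cvgD; exact: cvgM.
Qed.

Lemma ccvg_conj (u : nat -> R[i]) l : ccvg u l -> ccvg (fun n => conjc (u n)) (conjc l).
Proof.
move=> [ur ui]; split.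
- rewrite (_ : (fun _ => _) = fun n => Re (u n)); first by case: l ur {ui}.
  by apply/funext => n; case: (u n).
- rewrite (_ : (fun _ => _) = fun n => - Im (u n)).
    by case: l ui {ur} => a b /= ui; apply: cvgN.
  by apply/funext => n; case: (u n).
Qed.

(** Covers even integrands ([s = 1]) and odd ones ([s = -1]) at once: each half-line contributes
    through the primitive [G] of the right half. *)
Lemma Rintegral_reflected f g G (s : R) : continuous f -> rintegrable f ->
  continuous g -> (forall x, is_derive x (1 : R) G (g x)) ->
  (forall x, 0 <= x -> f x = g x) -> (forall x, x <= 0 -> f x = s * g (- x)) ->
  G n%:R @[n --> \oo] --> (0 : R) ->
  \int[mu]_x f x = - (1 + s) * G 0.
Proof.
move=> cf fi cg dG fp fn Gy.
have h0 : (1 + s) * (G n%:R - G 0) @[n --> \oo] --> - (1 + s) * G 0.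
  have -> : - (1 + s) * G 0 = (1 + s) * (0 - G 0) by ring.
  by apply: cvgM; [exact: cvg_cst|apply: cvgB => //; exact: cvg_cst].
apply: (cvg_unique (@Rhausdorff R) (cvg_integral_nat_itv fi)).
apply: (cvg_trans (near_eq_cvg _) h0); near=> n.
have n0 : 0 < n%:R :> R by rewrite ltr0n; near: n; exists 1%N.
have fS (i : interval R) : mu.-integrable [set` i] (EFin \o f).
  by apply: (integrableS measurableT) => //; exact: measurable_itv.
apply/esym.
have := @Rintegral_itvB R f (BLeft (- n%:R)) (BRight n%:R) 0 (fS _).
rewrite !bnd_simp oppr_le0 ltW// ?ltW// => /(_ isT isT)/eqP.
rewrite subr_eq => /eqP ->; rewrite Rintegral_itv_obnd_cbnd//.
have -> : \int[mu]_(x in `[0, n%:R]) f x = G n%:R - G 0.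
  rewrite -(Rintegral_FTC2 n0 cg dG); apply: eq_Rintegral => x.
  by rewrite inE/= in_itv/= => /andP[x0 _]; exact: fp.
have -> : \int[mu]_(x in `[- n%:R, 0]) f x = s * (G n%:R - G 0).
  transitivity (\int[mu]_(x in `[- n%:R, 0]) (s * g (- x))).
    apply: eq_Rintegral => x.
    by rewrite inE/= in_itv/= => /andP[_ x0]; exact: fn.
  have cg' : continuous (fun x => s * g (- x)).
    move=> x; apply: cvgM; first exact: cvg_cst.
    by apply: (@continuous_comp _ _ _ (@GRing.opp R) g);
      [exact: opp_continuous|exact: cg].
  (* A primitive on the left half-line, obtained by reflecting [G]. *)
  have dG' x : is_derive x (1 : R) (fun y => - s * G (- y)) (s * g (- x)).
    notypeclasses refine (is_derive_fun_eq _ _).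
      notypeclasses refine (is_derive_funM (is_derive_fun_cst _ _) _).
      notypeclasses refine (is_derive_fun_comp (dG _) _).
      exact: is_derive_funN (is_derive_fun_id _).
    by rewrite /=; ring.
  have Nn0 : - n%:R < 0 :> R by rewrite oppr_lt0.
  by rewrite (Rintegral_FTC2 Nn0 cg' dG') !oppr0 opprK; ring.
by ring.
Unshelve. all: by end_near. Qed.

Lemma ler_norm_cos_sin (a b x : R) : `|a * cos x + b * sin x| <= `|a| + `|b|.
Proof.
rewrite (le_trans (ler_normD _ _))// !normrM lerD// -[leRHS]mulr1 ler_wpM2l//.
- exact: cos_max.
- exact: sin_max.
Qed.

Lemma cvg_expRN_nat e (h : R -> R) (M : R) : 0 < e ->
  (forall x, `|h x| <= M) ->
  expR (- (e * n%:R)) * h n%:R @[n --> \oo] --> (0 : R).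
Proof.
move=> e0 hM.
have M0 : 0 <= M by rewrite (le_trans _ (hM 0)).
have hexp : expR (- (e * n%:R)) @[n --> \oo] --> (0 : R).
  have -> : (fun n => expR (- (e * n%:R))) = GRing.exp (expR (- e)).
    by apply/funext => n; rewrite -mulNr expRM_natr.
  by apply: cvg_expr; rewrite ger0_norm ?expR_ge0// expR_lt1 oppr_lt0.
apply: (@squeeze_cvgr _ _ _ _ (fun n => - (M * expR (- (e * n%:R))))
  (fun n => M * expR (- (e * n%:R)))).
- near=> n; rewrite -ler_norml normrM (@ger0_norm _ (expR _)) ?expR_ge0// mulrC.
  by rewrite ler_wpM2r ?expR_ge0.
- rewrite -oppr0; apply: cvgN; rewrite -(mulr0 M).
  by apply: cvgM => //; exact: cvg_cst.
- by rewrite -(mulr0 M); apply: cvgM => //; exact: cvg_cst.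
Unshelve. all: by end_near. Qed.

Lemma continuous_expR_norm e : continuous (fun y : R => expR (- (e * `|y|))).
Proof.
move=> y; apply: (@continuous_comp _ _ _ (fun y => - (e * `|y|)) (@expR R)).
  by apply: cvgN; apply: cvgM; [exact: cvg_cst|exact: norm_continuous].
exact: continuous_expR.
Qed.

Lemma continuous_cosM x : continuous (fun y : R => cos (x * y)).
Proof.
by apply: is_derive_continuous => y; derive_tac; reflexivity.
Qed.

Lemma continuous_sinM x : continuous (fun y : R => sin (x * y)).
Proof.
by apply: is_derive_continuous => y; derive_tac; reflexivity.
Qed.

(** The character [e^(iy)]; going through [cexp], it inherits the addition law and the modulus. *)
Definition phase y : R[i] := cexp (0 +i* y).

Lemma phaseE y : phase y = cos y +i* sin y.
Proof. by rewrite /phase /cexp /= expR0 mul1r. Qed.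

Lemma phaseD x y : phase (x + y) = phase x * phase y.
Proof. by rewrite /phase -cexpD; congr cexp; apply: complex_ext; rewrite /= ?addr0. Qed.

Lemma normc_phase y : normc (phase y) = 1.
Proof. by rewrite /phase normc_cexp expR0. Qed.

Lemma cmeasurable_phase d (T : measurableType d) (h : T -> R) :
  measurable_fun setT h -> cmeasurable (fun t => phase (h t)).
Proof. by move=> mh; apply/cmeasurable_cexp/cmeasurable_pair. Qed.

Lemma rintegrable_bounded f g : continuous f -> rintegrable f -> continuous g ->
  (forall x, `|g x| <= 1) -> rintegrable (fun x => f x * g x).
Proof.
move=> cf fi cg g1; apply: (@le_rintegrable _ _ (fun x => `|f x|)).
- by apply: measurable_funM; exact: continuous_measurable_fun.
- by move=> x; rewrite normrM ler_piMr.
- exact: integrable_norm.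
Qed.

(** The Fourier transform of the Abel weight is the Poisson kernel: the cosine part is even and
    counts twice, the sine part is odd and vanishes. *)
Lemma poisson_integral e x : 0 < e ->
  cintegral setT (fun y => (expR (- (e * `|y|)))%:C * phase (x * y)) =
  (2 * e / (e ^+ 2 + x ^+ 2))%:C.
Proof.
move=> e0; pose D := e ^+ 2 + x ^+ 2.
have D0 : D != 0 by rewrite gt_eqF// ltr_wpDr ?sqr_ge0// exprn_gt0.
(* [A] and [B] are the real and imaginary parts of the primitive [e^((-e + ix) y) / (-e + ix)]. *)
pose A y := expR (- (e * y)) * (- e / D * cos (x * y) + x / D * sin (x * y)).
pose B y := expR (- (e * y)) * (- x / D * cos (x * y) + - e / D * sin (x * y)).
have dA y : is_derive y (1 : R) A (expR (- (e * y)) * cos (x * y)).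
  by rewrite /A; derive_tac; rewrite /D; field.
have dB y : is_derive y (1 : R) B (expR (- (e * y)) * sin (x * y)).
  by rewrite /B; derive_tac; rewrite /D; field.
have bnd a b y : `|a * cos (x * y) + b * sin (x * y)| <= `|a| + `|b|.
  exact: ler_norm_cos_sin.
have cy : A n%:R @[n --> \oo] --> (0 : R) by exact: (cvg_expRN_nat e0 (bnd _ _)).
have sy : B n%:R @[n --> \oo] --> (0 : R) by exact: (cvg_expRN_nat e0 (bnd _ _)).
have ie : rintegrable (fun y => expR (- (e * `|y|))) by exact: rintegrable_expR_norm.
have ce := @continuous_expR_norm e.
rewrite /cintegral -complexr0; congr (_ +i* _).
- transitivity (\int[mu]_y (expR (- (e * `|y|)) * cos (x * y))).
    by apply: eq_Rintegral => y _; rewrite phaseE ReM /= mul0r subr0.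
  rewrite (@Rintegral_reflected _ (fun y => expR (- (e * y)) * cos (x * y)) A 1)//.
  + by rewrite /A !mulr0 oppr0 expR0 cos0 sin0; rewrite -/D; field.
  + by move=> y; apply: cvgM; [exact: ce|exact: continuous_cosM].
  + apply: rintegrable_bounded => //; first exact: continuous_cosM.
    by move=> y; exact: cos_max.
  + by apply: is_derive_continuous => y; derive_tac; reflexivity.
  + by move=> y y0; rewrite ger0_norm.
  + by move=> y y0; rewrite mul1r ler0_norm// !mulrN cosN.
- transitivity (\int[mu]_y (expR (- (e * `|y|)) * sin (x * y))).
    by apply: eq_Rintegral => y _; rewrite phaseE ImM /= mul0r addr0.
  rewrite (@Rintegral_reflected _ (fun y => expR (- (e * y)) * sin (x * y)) B (-1))//.
  + by rewrite subrr oppr0 mul0r.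
  + by move=> y; apply: cvgM; [exact: ce|exact: continuous_sinM].
  + apply: rintegrable_bounded => //; first exact: continuous_sinM.
    by move=> y; exact: sin_max.
  + by apply: is_derive_continuous => y; derive_tac; reflexivity.
  + by move=> y y0; rewrite ger0_norm.
  + by move=> y y0; rewrite mulN1r ler0_norm// !mulrN sinN mulrN !opprK.
Qed.

End fourier.

(** * Approximate identity and inversion formula *)

Section inversion.
Context {R : realType}.
Local Notation mu := (@lebesgue_measure R).
Implicit Types (x y e : R) (f g : R -> R).

Lemma complexrM x y : (x * y)%:C = x%:C * y%:C :> R[i].
Proof. exact: rmorphM. Qed.

Lemma cintegral_real f : cintegral setT (fun x => (f x)%:C) = (\int[mu]_x f x)%:C.
Proof.
rewrite /cintegral -complexr0; congr (_ +i* _).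
by rewrite /Rintegral integral0.
Qed.

Lemma cintegrable_real f : rintegrable f -> cintegrable setT (fun x => (f x)%:C).
Proof. by move=> fi; split => //; exact: integrable0. Qed.

Lemma cvg_harmonicZ x y : x + n.+1%:R^-1 * y @[n --> \oo] --> x.
Proof.
rewrite -[X in _ --> X]addr0 -(mul0r y).
apply: cvgD; first exact: cvg_cst.
by apply: cvgM; [exact: cvg_harmonic|exact: cvg_cst].
Qed.

Lemma measurable_sub_mul : measurable_fun [set: R * R] (fun p => - (p.1 * p.2)).
Proof.
by apply: measurable_funN; apply: measurable_funM;
  [exact: measurable_fst|exact: measurable_snd].
Qed.

(** The Poisson kernel is an approximate identity of mass [2 * pi]: the substitution
    [u = x + v / (n + 1)] makes the kernel the fixed function [2 / (1 + v^2)] and moves [n] into the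
    argument of [g], where continuity and boundedness allow dominated convergence. *)
Lemma poisson_approximation g (M x : R) : continuous g -> (forall u, `|g u| <= M) ->
  rintegrable g ->
  (\int[mu]_u (2 * n.+1%:R^-1 / (n.+1%:R^-1 ^+ 2 + (x - u) ^+ 2) * g u))
     @[n --> \oo] --> 2 * pi * g x.
Proof.
move=> cg gM ig.
have M0 : 0 <= M by rewrite (le_trans _ (gM 0)).
pose w n v := 2 * (oneDsqr v)^-1 * g (x + n.+1%:R^-1 * v).
have cw n : continuous (fun v : R => g (x + n.+1%:R^-1 * v)).
  move=> v; apply: (@continuous_comp _ _ _ (fun v : R => x + n.+1%:R^-1 * v) g).
    apply: cvgD; first exact: cvg_cst.
    by apply: cvgM; [exact: cvg_cst|exact: cvg_id].
  exact: cg.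
have subst n : \int[mu]_u (2 * n.+1%:R^-1 / (n.+1%:R^-1 ^+ 2 + (x - u) ^+ 2) * g u)
    = \int[mu]_v w n v.
  set e := n.+1%:R^-1.
  have e0 : 0 < e by rewrite invr_gt0 ltr0Sn.
  have D0 u : 0 < e ^+ 2 + (x - u) ^+ 2 by rewrite ltr_wpDr ?sqr_ge0// exprn_gt0.
  pose h u := 2 * e / (e ^+ 2 + (x - u) ^+ 2) * g u.
  have cD : continuous (fun u : R => 2 * e / (e ^+ 2 + (x - u) ^+ 2)).
    move=> u; apply: cvgM; first exact: cvg_cst.
    apply: cvgV; first by rewrite gt_eqF.
    apply: cvgD; first exact: cvg_cst.
    by apply: cvgM; apply: cvgB; (exact: cvg_cst || exact: cvg_id).
  have ch : continuous h by move=> u; apply: cvgM; [exact: cD|exact: cg].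
  have ih : rintegrable h.
    (* The kernel is largest at [u = x], with value [2 / e]. *)
    apply: (@le_rintegrable _ _ (fun u => 2 / e * `|g u|)).
    - exact: continuous_measurable_fun.
    - move=> u; rewrite normrM ler_wpM2r//.
      have := D0 u; set D := _ + _ => D0u.
      rewrite ger0_norm; last by rewrite divr_ge0 ?mulr_ge0 ?ltW.
      rewrite ler_pdivrMr// mulrAC ler_pdivlMr// -mulrA ler_wpM2l//.
      by rewrite /D expr2 lerDl sqr_ge0.
    - by apply: rintegrableZ; exact: integrable_norm.
  have [_ <-] := Rintegral_affine x e0 ch ih.
  apply: eq_Rintegral => v _; rewrite /h /w -/e /oneDsqr.
  have v0 : 1 + v ^+ 2 != 0 by rewrite gt_eqF ?oneDsqr_gt0.
  have -> : e ^+ 2 + (x - (x + e * v)) ^+ 2 = e ^+ 2 * (1 + v ^+ 2) by ring.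
  by field; rewrite v0 gt_eqF.
under eq_fun do rewrite subst.
have -> : 2 * pi * g x = \int[mu]_v (2 * (oneDsqr v)^-1 * g x).
  transitivity (\int[mu]_v ((2 * g x) * (oneDsqr v)^-1)); last first.
    by apply: eq_Rintegral => v _; ring.
  rewrite RintegralZl//; last exact: rintegrable_oneDsqrV.
  by rewrite Rintegral_oneDsqrV; ring.
have mJ : measurable_fun setT (fun v : R => 2 * (oneDsqr v)^-1).
  apply: measurable_funM => //.
  by apply: continuous_measurable_fun; exact: continuous_oneDsqrV.
have mw n : measurable_fun setT (w n).
  by apply: measurable_funM => //; exact: continuous_measurable_fun.
have cvw v : w n v @[n --> \oo] --> 2 * (oneDsqr v)^-1 * g x.
  apply: cvgM; first exact: cvg_cst.
  apply: (@cvg_comp _ _ _ (fun n => x + n.+1%:R^-1 * v) g).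
    exact: cvg_harmonicZ.
  exact: cg.
have bw n v : `|w n v| <= 2 * M * (oneDsqr v)^-1.
  have J0 : 0 <= 2 * (oneDsqr v)^-1 by rewrite mulr_ge0// invr_ge0 ltW// oneDsqr_gt0.
  by rewrite /w normrM (ger0_norm J0) [leRHS]mulrAC ler_wpM2l.
have iw : rintegrable (fun v : R => 2 * M * (oneDsqr v)^-1).
  by apply: rintegrableZ; exact: rintegrable_oneDsqrV.
have ml : measurable_fun setT (fun v => 2 * (oneDsqr v)^-1 * g x).
  by apply: measurable_funM.
by have [] := rdominated_convergence mw ml cvw bw iw.
Qed.

(** The Abel means [cintegral (u n)] converge to the left side, dominated by the integrable [gh],
    and to the right side, since an exchange of integrals turns them into Poisson integrals of
    [g]. *)
Lemma fourier_inversion g (M x : R) (gh : R -> R[i]) :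
  continuous g -> (forall u, `|g u| <= M) -> rintegrable g ->
  (forall y, gh y = cintegral setT (fun u => phase (- (y * u)) * (g u)%:C)) ->
  cintegrable setT gh ->
  cintegral setT (fun y => phase (x * y) * gh y) = (2 * pi * g x)%:C.
Proof.
move=> cg gM ig ghE igh.
have mgh := cintegrable_cmeasurable igh.
have mph : cmeasurable (fun y => phase (x * y)).
  by apply: cmeasurable_phase; apply: measurable_funM.
pose k n y := expR (- (n.+1%:R^-1 * `|y|)).
have n0 n : 0 < n.+1%:R^-1 :> R by rewrite invr_gt0 ltr0Sn.
pose u n y := (k n y)%:C * phase (x * y) * gh y.
have mk n : measurable_fun setT (k n).
  by apply: continuous_measurable_fun; exact: continuous_expR_norm.
have mu_ n : cmeasurable (u n).
  by do 2 apply: cmeasurableM => //; exact: cmeasurable_real.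
have ku y : ccvg (u ^~ y) (phase (x * y) * gh y).
  have -> : u ^~ y = fun n => (k n y)%:C * (phase (x * y) * gh y).
    by apply/funext => n; rewrite /u mulrA.
  rewrite -[X in ccvg _ X]mul1r.
  apply: ccvgM; last exact: ccvg_cst.
  apply: ccvg_real; rewrite -expR0 -[X in expR X]oppr0.
  have h : - (n.+1%:R^-1 * `|y|) @[n --> \oo] --> (- 0 : R).
    apply: cvgN; rewrite -(mul0r `|y|).
    by apply: cvgM; [exact: cvg_harmonic|exact: cvg_cst].
  by apply: continuous_cvg => //; exact: continuous_expR.
have ub n y : normc (u n y) <= `|Re (gh y)| + `|Im (gh y)|.
  rewrite /u normcM normcM normc_phase mulr1 normc_real (le_trans _ (normc_le _))//.
  rewrite ler_piMl ?normc_ge0// ger0_norm ?expR_ge0// expR_le1 oppr_le0.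
  by rewrite mulr_ge0// ltW.
have [_ cv] := cdominated_convergence mu_ ku ub (rintegrable_normc igh).
apply: (ccvg_unique cv).
(* Integrating over [y] first leaves the transform of the weight at [x - v], that is, the Poisson
   kernel. *)
have eqn n : cintegral setT (u n) =
    (\int[mu]_v (2 * n.+1%:R^-1 / (n.+1%:R^-1 ^+ 2 + (x - v) ^+ 2) * g v))%:C.
  transitivity (cintegral setT (fun y => (k n y)%:C * phase (x * y) *
      cintegral setT (fun v => phase (- (y * v)) * (g v)%:C))).
    by congr cintegral; apply/funext => y; rewrite /u ghE.
  rewrite (@fourier_exchange _ _ (fun v => (g v)%:C) (fun y v => phase (- (y * v)))).
  - rewrite -cintegral_real; congr cintegral; apply/funext => v.
    rewrite [RHS]complexrM -poisson_integral//; congr (cintegral _ _ * _).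
    apply/funext => y; rewrite -mulrA -phaseD; congr (_ * phase _).
    by rewrite mulrBl [y * v]mulrC.
  - apply: (@dominated_cintegrable _ _ (k n)).
    + by apply: cmeasurableM => //; exact: cmeasurable_real.
    + by move=> y; rewrite normcM normc_phase mulr1 normc_real ger0_norm ?expR_ge0.
    + exact: rintegrable_expR_norm.
  - exact: cintegrable_real.
  - by apply: cmeasurable_phase; exact: measurable_sub_mul.
  - by move=> y v; rewrite normc_phase.
have -> : (fun n => cintegral setT (u n)) = fun n =>
    (\int[mu]_v (2 * n.+1%:R^-1 / (n.+1%:R^-1 ^+ 2 + (x - v) ^+ 2) * g v))%:C.
  by apply/funext => n; exact: eqn.
by apply: ccvg_real; exact: (poisson_approximation cg gM ig).
Qed.

(** Each component depends continuously on [y], by domination under the integral sign, and is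
    therefore measurable. *)
Lemma continuous_phase_integral (g : R -> R[i]) : cintegrable setT g ->
  cmeasurable (fun y => cintegral setT (fun u => phase (y * u) * g u)).
Proof.
move=> ig.
have mg := cintegrable_cmeasurable ig.
have mph y : cmeasurable (fun u => phase (y * u)).
  by apply: cmeasurable_phase; apply: measurable_funM.
have key (h : R -> R) : rintegrable h -> forall p : R -> R -> R,
    (forall y u, `|p y u| <= `|h u|) ->
    (forall y, measurable_fun setT (p y)) ->
    (forall u, continuous (p ^~ u)) ->
    measurable_fun setT (fun y => \int[mu]_u p y u).
  move=> ih p ph mp cp; apply: continuous_measurable_fun => y.
  have yI : y \in `](y - 1), (y + 1)[.
    by rewrite in_itv/= ltrBlDr !ltrDl ltr01.
  apply: (@continuity_under_integral _ _ _ mu p setT measurableT (y - 1) (y + 1)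
    _ _ (fun u => `|h u|) _ _ y); last by rewrite inE.
  - move=> z _; apply: (@le_rintegrable _ _ (fun u => `|h u|)) => //.
    exact: integrable_norm.
  - by apply: aeW => u _ z _; exact: cp.
  - exact: integrable_norm.
  - by move=> z _; apply: aeW => u _; exact: ph.
pose r u := `|Re (g u)| + `|Im (g u)|.
have ir : rintegrable r by exact: rintegrable_normc.
have bnd y u : normc (phase (y * u) * g u) <= `|r u|.
  rewrite normcM normc_phase mul1r (le_trans (normc_le _))//.
  exact: (ler_norm (r u)).
have cM a b u : continuous (fun y : R => a * cos (y * u) + b * sin (y * u)).
  by apply: is_derive_continuous => y; derive_tac; reflexivity.
split; apply: (key r ir).
- by move=> y u; rewrite (le_trans (ler_Re_normc _)).
- by move=> y; case: (cmeasurableM (mph y) mg).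
- move=> u; rewrite (_ : (fun _ => _) =
    fun y => Re (g u) * cos (y * u) + (- Im (g u)) * sin (y * u)); first exact: cM.
  by apply/funext => y; rewrite ReM phaseE /=; ring.
- by move=> y u; rewrite (le_trans (ler_Im_normc _)).
- by move=> y; case: (cmeasurableM (mph y) mg).
- move=> u; rewrite (_ : (fun _ => _) =
    fun y => Im (g u) * cos (y * u) + Re (g u) * sin (y * u)); first exact: cM.
  by apply/funext => y; rewrite ImM phaseE /=; ring.
Qed.

End inversion.

(** * The Gamma function *)

Section elementary_inequalities.
Context {R : realType}.
Local Notation mu := (@lebesgue_measure R).
Implicit Types (x y : R).

Lemma le_at0_of_derive_ge0 (f F : R -> R) x : continuous f ->
  (forall y, is_derive y (1 : R) F (f y)) -> (forall y, 0 <= y -> 0 <= f y) ->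
  0 <= x -> F 0 <= F x.
Proof.
move=> cf dF f0; rewrite le_eqVlt => /predU1P[<-//|x0].
rewrite -subr_ge0 -(Rintegral_FTC2 x0 cf dF); apply: Rintegral_ge0 => y /=.
by rewrite in_itv/= => /andP[y0 _]; exact: f0.
Qed.

Lemma sin_le x : 0 <= x -> sin x <= x.
Proof.
have d y : is_derive y (1 : R) (fun z => z - sin (1 * z)) (1 - cos (1 * y)).
  by derive_tac; ring.
have c : continuous (fun y : R => 1 - cos (1 * y)).
  by apply: is_derive_continuous => y; derive_tac; reflexivity.
move=> x0; have := le_at0_of_derive_ge0 c d _ x0.
rewrite !mul1r sin0 subrr subr_ge0; apply => y _.
by rewrite mul1r subr_ge0 cos_le1.
Qed.

(** Integrates [sin y <= y] from 0 to [x]; evenness gives negative [x]. *)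
Lemma cos_ge x : 1 - x ^+ 2 / 2 <= cos x.
Proof.
have d y : is_derive y (1 : R) (fun z => z * z / 2 + cos (1 * z)) (y - sin (1 * y)).
  by derive_tac; field.
have c : continuous (fun y : R => y - sin (1 * y)).
  by apply: is_derive_continuous => y; derive_tac; reflexivity.
have pos y : 0 <= y -> 1 - y ^+ 2 / 2 <= cos y.
  move=> y0; have := le_at0_of_derive_ge0 c d _ y0.
  rewrite mul0r mul0r mulr0 cos0 add0r mul1r lerBlDl -expr2; apply => z z0.
  by rewrite mul1r subr_ge0 sin_le.
by have := pos `|x| (normr_ge0 x); rewrite real_normK ?num_real// cos_norm.
Qed.

(** With [h = x / 2 >= 0] the bracket is [(e^h - e^-h)^2], and [e^h - e^-h >= h]. Replacing a square
    by exponentials lets it be integrated exactly against [eul], where they only shift the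
    parameter. *)
Lemma sqr_le_cosh x : x ^+ 2 <= 4 * (expR x - 2 + expR (- x)).
Proof.
have pos y : 0 <= y -> y ^+ 2 <= 4 * (expR y - 2 + expR (- y)).
  move=> y0; pose h := y / 2.
  have h0 : 0 <= h by rewrite divr_ge0.
  have -> : y = h + h by rewrite /h; field.
  rewrite [- (h + h)]opprD !expRD.
  have h1 : h <= expR h - expR (- h).
    rewrite lerBrDr (le_trans _ (expR_ge1Dx h))// addrC lerD2r.
    by rewrite expR_le1 oppr_le0.
  have -> : expR h * expR h - 2 + expR (- h) * expR (- h) =
      (expR h - expR (- h)) ^+ 2.
    by rewrite sqrrB expRxMexpNx_1; ring.
  have : h ^+ 2 <= (expR h - expR (- h)) ^+ 2.
    by rewrite ler_pXn2r// nnegrE// (le_trans h0).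
  by rewrite (_ : (h + h) ^+ 2 = 4 * h ^+ 2); [rewrite ler_pM2l|ring].
have [x0|x0] := leP 0 x; first exact: pos.
have := pos (- x); rewrite oppr_ge0 sqrrN opprK => /(_ (ltW x0)).
by rewrite addrAC [expR (- x) + _]addrC addrAC.
Qed.

End elementary_inequalities.

(** * The Euler integrand in the logarithmic variable *)

Section gamma_kernel.
Context {R : realType}.
Local Notation mu := (@lebesgue_measure R).
Implicit Types (a b u x y : R).

(* The integrand of Gamma at the real point [a] after the substitution [x = e^u]. *)
Definition eul a u := expR (a * u - expR u).

Lemma eul_ge0 a u : 0 <= eul a u. Proof. exact: expR_ge0. Qed.

Lemma eulS a u : eul (a + 1) u = expR u * eul a u.
Proof. by rewrite /eul -expRD; congr expR; ring. Qed.

Lemma continuous_eul a : continuous (eul a).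
Proof.
by apply: is_derive_continuous => u; rewrite /eul; derive_tac; reflexivity.
Qed.

(** Up to a constant, [eul a u] is at most [e^(-a |u|)]: on the left because [expR u >= 0], on the
    right because [expR u] exceeds a line of slope [2 * a]. *)
Lemma eul_le a : 0 < a -> exists C, forall u, eul a u <= C * (oneDsqr u)^-1.
Proof.
move=> a0; have [C hC] := expR_norm_le a0.
(* The tangent to the exponential at [ln (2 * a)] is [2 * a * u - m]. *)
pose m := 2 * a * (ln (2 * a) - 1); exists (expR `|m| * C) => u.
rewrite -mulrA (le_trans _ (ler_wpM2l _ (hC u))) ?expR_ge0// -expRD ler_expR.
have [u0|u0] := leP u 0.
  rewrite (ler0_norm u0) mulrN opprK [leRHS]addrC lerD2l.
  by rewrite (@le_trans _ _ 0)// oppr_le0 expR_ge0.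
rewrite (gtr0_norm u0) lerBlDr.
have h : 2 * a * (1 + (u - ln (2 * a))) <= expR u.
  have a2 : 0 < 2 * a by rewrite mulr_gt0.
  rewrite -ler_pdivlMl// (le_trans (expR_ge1Dx _))// expRB lnK//.
  by rewrite mulrC.
have hm : m <= `|m| by exact: ler_norm.
have : 2 * a * (1 + (u - ln (2 * a))) = 2 * (a * u) - m by rewrite /m; ring.
by lra.
Qed.

Lemma rintegrable_eul a : 0 < a -> rintegrable (eul a).
Proof.
move=> a0; have [C hC] := eul_le a0.
apply: (@le_rintegrable _ _ (fun u => C * (oneDsqr u)^-1)).
- by apply: continuous_measurable_fun; exact: continuous_eul.
- by move=> u; rewrite ger0_norm ?eul_ge0.
- by apply: rintegrableZ; exact: rintegrable_oneDsqrV.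
Qed.

Lemma eul_bounded a : 0 < a -> exists M, forall u, `|eul a u| <= M.
Proof.
move=> a0; have [C hC] := eul_le a0; exists C => u.
have C0 : 0 <= C.
  rewrite -(@pmulr_lge0 _ (oneDsqr 0)^-1) ?invr_gt0 ?oneDsqr_gt0//.
  by rewrite (le_trans _ (hC 0))// eul_ge0.
rewrite ger0_norm ?eul_ge0// (le_trans (hC u))// ler_piMr//.
by rewrite invf_le1 ?oneDsqr_gt0// oneDsqr_ge1.
Qed.

(** The boundary terms of the integration by parts, at both ends: [s = 1] and [s = -1]. *)
Lemma cvg_eul a (s : R) (h : R -> R) : 0 < a -> s ^+ 2 = 1 ->
  (forall x, `|h x| <= 1) ->
  eul a (s * n%:R) * h (s * n%:R) @[n --> \oo] --> (0 : R).
Proof.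
move=> a0 s1 h1; have [C hC] := eul_le a0.
have C0 : 0 <= C.
  rewrite -(@pmulr_lge0 _ (oneDsqr 0)^-1) ?invr_gt0 ?oneDsqr_gt0//.
  by rewrite (le_trans _ (hC 0))// eul_ge0.
have bnd n : `|eul a (s * n%:R) * h (s * n%:R)| <= C * n.+1%:R^-1.
  rewrite normrM (@ger0_norm _ (eul _ _)) ?eul_ge0//.
  rewrite (@le_trans _ _ (eul a (s * n%:R)))//.
    by rewrite ler_piMr// eul_ge0.
  rewrite (le_trans (hC _))// ler_wpM2l// lef_pV2 ?posrE ?oneDsqr_gt0//.
  rewrite /oneDsqr exprMn s1 mul1r -natrX -natr1 [leRHS]addrC lerD2r ler_nat.
  by rewrite expnS expn1; case: n => // n; rewrite leq_pmulr.
have hz : C * n.+1%:R^-1 @[n --> \oo] --> (0 : R).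
  by rewrite -(mulr0 C); apply: cvgM; [exact: cvg_cst|exact: cvg_harmonic].
apply: (@squeeze_cvgr _ _ _ _ (fun n => - (C * n.+1%:R^-1))
  (fun n => C * n.+1%:R^-1)) => //.
- by near=> n; rewrite -ler_norml.
- by rewrite -oppr0; exact: cvgN.
Unshelve. all: by end_near. Qed.

Lemma rintegrable_eul_trig a (h : R -> R) : 0 < a -> continuous h ->
  (forall x, `|h x| <= 1) -> rintegrable (fun u => eul a u * h u).
Proof.
move=> a0 ch h1; apply: rintegrable_bounded => //; first exact: continuous_eul.
exact: rintegrable_eul.
Qed.

(** Integration by parts: the derivative of [eul a u * h u] is [a * eul a u * h u + eul a u * h' u -
    eul (a + 1) u * h u], and its integral vanishes. Cosine and sine for [h] give the functional
    equation of Gamma. *)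
Lemma Rintegral_eul_derive a (h h' : R -> R) : 0 < a ->
  (forall u, is_derive u (1 : R) h (h' u)) -> continuous h' ->
  (forall u, `|h u| <= 1) -> rintegrable (fun u => eul a u * h' u) ->
  \int[mu]_u (eul (a + 1) u * h u) =
  a * \int[mu]_u (eul a u * h u) + \int[mu]_u (eul a u * h' u).
Proof.
move=> a0 dh ch' h1 ih'; have ch := is_derive_continuous dh.
have ce := @continuous_eul.
have i1 : rintegrable (fun u => eul (a + 1) u * h u).
  by apply: rintegrable_eul_trig; rewrite // addr_gt0.
have i0 : rintegrable (fun u => eul a u * h u) by exact: rintegrable_eul_trig.
pose f u := a * (eul a u * h u) + eul a u * h' u - eul (a + 1) u * h u.
have i01 : rintegrable (fun u => a * (eul a u * h u) + eul a u * h' u).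
  by apply: rintegrableD => //; exact: rintegrableZ.
have fi : rintegrable f by have := integrableB measurableT i01 i1; exact: eq_integrable.
have : \int[mu]_u f u = 0.
  apply: (@Rintegral_derive_eq0 _ f (fun u => eul a u * h u)) => //.
  - move=> u; apply: cvgB; last by apply: cvgM; [exact: ce|exact: ch].
    apply: cvgD; last by apply: cvgM; [exact: ce|exact: ch'].
    apply: cvgM; first exact: cvg_cst.
    by apply: cvgM; [exact: ce|exact: ch].
  - move=> u; notypeclasses refine (is_derive_fun_eq _ _).
      notypeclasses refine (is_derive_funM _ (dh u)).
      rewrite /eul; derive_tac; reflexivity.
    by rewrite /f eulS /eul; ring.
  - have := @cvg_eul a 1 h a0 (expr1n _ _) h1.
    by under eq_fun do rewrite mul1r.
  - have := @cvg_eul a (-1) h a0 (sqrr_sign R 1) h1.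
    by under eq_fun do rewrite mulN1r.
rewrite RintegralB// RintegralD//; last exact: rintegrableZ.
by rewrite RintegralZl// => /eqP; rewrite subr_eq0 => /eqP.
Qed.

End gamma_kernel.

(** * Functional equation, decay and non-vanishing of Gamma *)

Section gamma.
Context {R : realType}.
Local Notation mu := (@lebesgue_measure R).
Implicit Types (a b u x y : R) (w : R[i]).

Lemma Re_phase_real y x : Re (phase y * x%:C) = x * cos y.
Proof. by rewrite ReM phaseE /= mulr0 subr0 mulrC. Qed.

Lemma Im_phase_real y x : Im (phase y * x%:C) = x * sin y.
Proof. by rewrite ImM phaseE /= mulr0 add0r mulrC. Qed.

Lemma Re_cintegral (D : set R) (f : R -> R[i]) :
  Re (cintegral D f) = \int[mu]_(x in D) Re (f x).
Proof. by []. Qed.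

Lemma Im_cintegral (D : set R) (f : R -> R[i]) :
  Im (cintegral D f) = \int[mu]_(x in D) Im (f x).
Proof. by []. Qed.

Lemma cintegrable_eul a b : 0 < a ->
  cintegrable setT (fun u => phase (b * u) * (eul a u)%:C).
Proof.
move=> a0; apply: (@dominated_cintegrable _ _ (eul a)).
- apply: cmeasurableM.
    by apply: cmeasurable_phase; apply: measurable_funM.
  apply: cmeasurable_real; apply: continuous_measurable_fun.
  exact: continuous_eul.
- by move=> u; rewrite normcM normc_phase mul1r normc_real ger0_norm ?eul_ge0.
- exact: rintegrable_eul.
Qed.

Lemma GammaE a b : 0 < a ->
  Gamma (a +i* b) = cintegral setT (fun u => phase (b * u) * (eul a u)%:C).
Proof.
(* As [0 < a], the point lies where [continuation] returns the integral itself. *)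
move=> a0; rewrite /Gamma /continuation ifT; last by rewrite inE.
have cpE x : 0 < x -> cpow x (a +i* b - 1) * (expR (- x))%:C =
    (x^-1)%:C * (phase (b * ln x) * (eul a (ln x))%:C).
  move=> x0; rewrite /cpow /cexp phaseE /eul lnK//.
  (* Inserting [- x + x] exhibits the exponent of [eul a (ln x)]; the surplus [expR x] cancels
     [expR (- x)], and [- ln x] gives the Jacobian. *)
  have -> : Re ((a +i* b - 1) * (ln x)%:C) = a * ln x - x + x - ln x.
    by rewrite ReM ReD /=; ring.
  have -> : Im ((a +i* b - 1) * (ln x)%:C) = b * ln x.
    by rewrite ImM ReD ImD /=; ring.
  have -> : (x^-1)%:C = (expR (- ln x))%:C :> R[i] by rewrite expRN lnK.
  have -> : expR (a * ln x - x + x - ln x) =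
      expR (- ln x) * expR (a * ln x - x) * expR x.
    by rewrite -!expRD; congr expR; ring.
  have exN : expR x * expR (- x) = 1 by exact: expRxMexpNx_1.
  set p := expR (- ln x); set q := expR (a * ln x - x).
  transitivity ((p * q * (expR x * expR (- x)))%:C *
    (cos (b * ln x) +i* sin (b * ln x))).
    by apply: complex_ext; rewrite !(ReM, ImM) /=; ring.
  by rewrite exN; apply: complex_ext; rewrite !(ReM, ImM) /=; ring.
have i1 := rintegrable_eul_trig a0 (@continuous_cosM R b) (fun _ => cos_max _).
have i2 := rintegrable_eul_trig a0 (@continuous_sinM R b) (fun _ => sin_max _).
have c1 : continuous (fun u => eul a u * cos (b * u)).
  by move=> u; apply: cvgM; [exact: continuous_eul|exact: continuous_cosM].
have c2 : continuous (fun u => eul a u * sin (b * u)).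
  by move=> u; apply: cvgM; [exact: continuous_eul|exact: continuous_sinM].
apply: complex_ext.
- rewrite [LHS]Re_cintegral [RHS]Re_cintegral.
  transitivity (\int[mu]_u (eul a u * cos (b * u))); last first.
    by apply: eq_Rintegral => u _; rewrite Re_phase_real.
  rewrite -(Rintegral_ln c1 i1).2; apply: eq_Rintegral => x.
  rewrite inE => xI; have x0 : 0 < x by move: xI; rewrite /= in_itv/= andbT.
  by rewrite cpE// ReM Re_phase_real [Re _]/= [Im _%:C]/= mul0r subr0 mulrC.
- rewrite [LHS]Im_cintegral [RHS]Im_cintegral.
  transitivity (\int[mu]_u (eul a u * sin (b * u))); last first.
    by apply: eq_Rintegral => u _; rewrite Im_phase_real.
  rewrite -(Rintegral_ln c2 i2).2; apply: eq_Rintegral => x.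
  rewrite inE => xI; have x0 : 0 < x by move: xI; rewrite /= in_itv/= andbT.
  by rewrite cpE// ImM Im_phase_real [Re _%:C]/= [Im _%:C]/= mul0r addr0 mulrC.
Qed.

Lemma GammaRe a b : 0 < a -> Gamma (a +i* b) =
  (\int[mu]_u (eul a u * cos (b * u))) +i* (\int[mu]_u (eul a u * sin (b * u))).
Proof.
move=> a0; rewrite GammaE// /cintegral; congr (_ +i* _).
- by apply: eq_Rintegral => u _; rewrite Re_phase_real.
- by apply: eq_Rintegral => u _; rewrite Im_phase_real.
Qed.

Lemma Gamma_functional w : 0 < Re w -> Gamma (w + 1) = w * Gamma w.
Proof.
case: w => a b /= a0.
have -> : a +i* b + 1 = (a + 1) +i* b by apply: complex_ext; rewrite /= ?addr0.
have dc u : is_derive u (1 : R) (fun u => cos (b * u)) (- b * sin (b * u)).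
  by derive_tac; ring.
have ds u : is_derive u (1 : R) (fun u => sin (b * u)) (b * cos (b * u)).
  by derive_tac; ring.
have ic := rintegrable_eul_trig a0 (@continuous_cosM R b) (fun _ => cos_max _).
have is_ := rintegrable_eul_trig a0 (@continuous_sinM R b) (fun _ => sin_max _).
have mE (k : R) (h : R -> R) : (fun u => eul a u * (k * h u)) = fun u => k * (eul a u * h u).
  by apply/funext => u; ring.
rewrite !GammaRe//; last by rewrite addr_gt0.
rewrite (Rintegral_eul_derive a0 dc) ?(Rintegral_eul_derive a0 ds)//.
- rewrite mE RintegralZl// mE RintegralZl//.
  by apply: complex_ext; rewrite ?ReM ?ImM /=; ring.
- by apply: is_derive_continuous => u; derive_tac; reflexivity.
- by move=> u; exact: sin_max.
- by rewrite mE; exact: rintegrableZ.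
- by apply: is_derive_continuous => u; derive_tac; reflexivity.
- by move=> u; exact: cos_max.
- by rewrite mE; exact: rintegrableZ.
Qed.

(** For [a > 0], the real value of Gamma at [a], in which bounds for complex arguments are
    expressed. *)
Definition eulint a := \int[mu]_u eul a u.

Lemma eulintS a : 0 < a -> eulint (a + 1) = a * eulint a.
Proof.
move=> a0; have a10 : 0 < a + 1 by rewrite addr_gt0.
have E x : 0 < x -> Re (Gamma (x +i* 0)) = eulint x.
  move=> x0; rewrite GammaRe//=; apply: eq_Rintegral => u _.
  by rewrite mul0r cos0 mulr1.
have := @Gamma_functional (a +i* 0) a0; rewrite [a +i* 0 + 1](_ : _ = (a + 1) +i* 0).
  by move=> /(congr1 Re); rewrite ReM !E//= mul0r subr0.
by apply: complex_ext; rewrite /= ?addr0.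
Qed.

Lemma eulint_gt0 a : 0 < a -> 0 < eulint a.
Proof.
(* A lower bound of [eul a] on [[0, 1]], where [a * u >= 0] and [expR u <= expR 1]. *)
move=> a0; pose m := expR (- expR 1 : R).
have m0 : 0 < m by exact: expR_gt0.
apply: (lt_le_trans m0).
have ie := rintegrable_eul a0.
have iS : mu.-integrable `[0, 1] (EFin \o eul a).
  by apply: (integrableS measurableT) => //; exact: measurable_itv.
apply: (@le_trans _ _ (\int[mu]_(u in `[0, 1]) eul a u)).
  have dm (y : R) : is_derive y (1 : R) (fun z => m * z) m by derive_tac; ring.
  have cm : continuous (cst m : R -> R) by exact: cst_continuous.
  have := Rintegral_FTC2 ltr01 cm dm; rewrite mulr1 mulr0 subr0 => <-.
  apply: le_Rintegral => //.
    apply: continuous_compact_integrable; first exact: segment_compact.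
    exact: continuous_subspaceT.
  move=> u /=; rewrite in_itv/= => /andP[u0 u1].
  rewrite ler_expR (@le_trans _ _ (- expR u))// ?lerN2 ?ler_expR//.
  by rewrite lerDr mulr_ge0// ltW.
rewrite /eulint /Rintegral fine_le//.
- exact: integrable_fin_num.
- exact: integrable_fin_num.
- apply: ge0_subset_integral => //.
  + by apply/measurable_EFinP; exact: rintegrable_measurable.
  + by move=> u _; rewrite lee_fin eul_ge0.
Qed.

Lemma normc_Gamma_le w : 0 < Re w -> normc (Gamma w) <= 2 * eulint (Re w).
Proof.
case: w => a b /= a0; rewrite GammaE//; apply: normc_cintegral_le.
- exact: (cintegrable_cmeasurable (cintegrable_eul b a0)).
- by move=> u; rewrite normcM normc_phase mul1r normc_real ger0_norm ?eul_ge0.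
- exact: rintegrable_eul.
Qed.

(** Two functional equations give [Gamma (w + 2) = (w + 1) * w * Gamma w], and for [Re w >= 1] both
    linear factors have modulus at least [sqrt (1 + b^2)]. Quadratic decay is enough for
    integrability on vertical lines. *)
Lemma normc_Gamma_decay a b : 1 <= a ->
  normc (Gamma (a +i* b)) <= 2 * eulint (a + 2) * (oneDsqr b)^-1.
Proof.
move=> a1; have a0 : 0 < a by rewrite (lt_le_trans ltr01).
rewrite ler_pdivlMr ?oneDsqr_gt0//.
have h1 := @Gamma_functional (a +i* b) a0.
have h2 : Gamma (a +i* b + 1 + 1) = (a +i* b + 1) * Gamma (a +i* b + 1).
  by apply: Gamma_functional; rewrite ReD /= addr_gt0.
have := @normc_Gamma_le (a +i* b + 1 + 1).
rewrite h2 h1 !ReD /= => H; have {}H := H (addr_gt0 (addr_gt0 a0 ltr01) ltr01).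
rewrite (_ : a + 2 = a + 1 + 1); last by ring.
apply: le_trans H; rewrite mulrA normcM mulrC ler_wpM2r ?normc_ge0//.
rewrite normcM /= -sqrtrM ?addr_ge0 ?sqr_ge0//.
have -> : oneDsqr b = Num.sqrt (oneDsqr b ^+ 2).
  by rewrite sqrtr_sqr ger0_norm// ltW// oneDsqr_gt0.
rewrite ler_wsqrtr// addr0 expr2 ler_pM ?(ltW (oneDsqr_gt0 _))// lerD2r expr2.
- by rewrite -[leLHS]mulr1 ler_pM// ler_wpDl// ltW.
- by rewrite -[leLHS]mulr1 ler_pM.
Qed.

Lemma cmeasurable_Gamma a : 0 < a -> cmeasurable (fun y => Gamma (a +i* y)).
Proof.
move=> a0; rewrite (_ : (fun _ => _) =
  fun y => cintegral setT (fun u => phase (y * u) * (eul a u)%:C)).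
  apply: continuous_phase_integral; apply: cintegrable_real.
  exact: rintegrable_eul.
by apply/funext => y; rewrite GammaE.
Qed.

Lemma cintegrable_Gamma a : 1 <= a -> cintegrable setT (fun y => Gamma (a +i* - y)).
Proof.
move=> a1; have a0 : 0 < a by rewrite (lt_le_trans ltr01).
apply: (@dominated_cintegrable _ _ (fun y => 2 * eulint (a + 2) * (oneDsqr y)^-1)).
- have [r i] := cmeasurable_Gamma a0.
  by split; [apply: (measurableT_comp r)|apply: (measurableT_comp i)].
- move=> y; rewrite (le_trans (normc_Gamma_decay _ a1))//.
  by rewrite /oneDsqr sqrrN.
- by apply: rintegrableZ; exact: rintegrable_oneDsqrV.
Qed.

Lemma Gamma_neq0_large (N t : R) : 1 < N -> 2 * t ^+ 2 < N - 1 -> Gamma (N +i* t) != 0.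
Proof.
move=> N1 ht; have N0 : 0 < N by rewrite (lt_trans ltr01).
have N10 : 0 < N - 1 by rewrite subr_gt0.
pose L := ln N.
have iN := cintegrable_eul t N0.
(* This rotation centres the oscillation at [L = ln N], the maximum of [eul N]. *)
have E : phase (- (t * L)) * Gamma (N +i* t) =
    cintegral setT (fun u => phase (t * (u - L)) * (eul N u)%:C).
  rewrite GammaE// -cintegralZ//; congr cintegral; apply/funext => u.
  by rewrite mulrA -phaseD; congr (phase _ * _); ring.
suff : 0 < Re (phase (- (t * L)) * Gamma (N +i* t)).
  by apply: contraTneq => ->; rewrite mulr0 ltxx.
rewrite E Re_cintegral.
(* With [v = u - L], this is [eul N u * (1 - 2 * t^2 * (e^v - 2 + e^-v))], a minorant of
   [eul N u * cos (t * v)]; the factors [e^v = e^u / N] and [e^-v = N * e^-u] shift the parameter to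
   [N + 1] and [N - 1]. *)
pose k u := (1 + 4 * t ^+ 2) * eul N u +
  (- (2 * t ^+ 2)) * (N^-1 * eul (N + 1) u + N * eul (N - 1) u).
have i1 := rintegrable_eul N0.
have i2 : rintegrable (eul (N + 1)) by apply: rintegrable_eul; rewrite addr_gt0.
have i3 := rintegrable_eul N10.
have ik2 : rintegrable (fun u => N^-1 * eul (N + 1) u + N * eul (N - 1) u).
  by apply: rintegrableD; exact: rintegrableZ.
have ik : rintegrable k by apply: rintegrableD; exact: rintegrableZ.
(* By the recurrence the integral of the bracket is [eulint N * (1 + N / (N - 1) - 2) = eulint N /
   (N - 1)]. *)
have Ek : \int[mu]_u k u = eulint N * (1 - 2 * t ^+ 2 / (N - 1)).
  rewrite RintegralD//; try exact: rintegrableZ.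
  rewrite RintegralZl// RintegralZl// RintegralD//; try exact: rintegrableZ.
  rewrite RintegralZl// RintegralZl// -!/(eulint _) eulintS//.
  have := eulintS N10; rewrite subrK => ->.
  by field; rewrite !gt_eqF.
apply: (@lt_le_trans _ _ (\int[mu]_u k u)).
  rewrite Ek mulr_gt0 ?eulint_gt0// subr_gt0 ltr_pdivrMr// mul1r//.
have [ir _] : cintegrable setT (fun u => phase (t * (u - L)) * (eul N u)%:C).
  have := cintegrableZ (phase (- (t * L))) iN; congr cintegrable; apply/funext => u.
  by rewrite mulrA -phaseD; congr (phase _ * _); ring.
apply: le_Rintegral => // u _; rewrite Re_phase_real.
have -> : k u = eul N u * (1 - 2 * t ^+ 2 * (expR (u - L) - 2 + expR (- (u - L)))).
  rewrite /k eulS expRN expRB lnK//.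
  have -> : eul (N - 1) u = eul N u / expR u.
    rewrite -[N in RHS](subrK 1) eulS mulrAC mulfV ?mul1r//.
    by rewrite gt_eqF ?expR_gt0.
  by field; rewrite !gt_eqF ?expR_gt0.
rewrite ler_wpM2l ?eul_ge0// (le_trans _ (cos_ge _))// lerD2l lerN2.
rewrite exprMn ler_pdivrMr//.
have := sqr_le_cosh (u - L); set q := expR _ - 2 + _ => hq.
rewrite (@le_trans _ _ (t ^+ 2 * (4 * q)))// ?ler_wpM2l ?sqr_ge0//.
by rewrite le_eqVlt; apply/orP; left; apply/eqP; ring.
Qed.

Lemma Gamma_neq0 w : 0 < Re w -> Gamma w != 0.
Proof.
have key n : forall z : R[i], 0 < Re z -> Gamma (z + n%:R) != 0 -> Gamma z != 0.
  elim: n => [z _|n IH z z0]; first by rewrite addr0.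
  rewrite -natr1 addrA [z + _ + _]addrAC => h.
  have z10 : 0 < Re (z + 1) by rewrite ReD /= addr_gt0.
  have := IH _ z10 h; rewrite Gamma_functional//.
  by rewrite mulf_eq0 negb_or => /andP[].
(* With this [n], the real part [N = Re w + n] satisfies [N - 1 > 2 * (Im w)^2]. *)
move=> w0; pose n := (Num.bound (2 * Im w ^+ 2)).+1.
apply: (key n) => //.
have -> : w + n%:R = (Re w + n%:R) +i* Im w.
  have -> : (n%:R : R[i]) = (n%:R : R)%:C by rewrite rmorph_nat.
  by apply: complex_ext; rewrite (ReD, ImD) /= ?addr0.
have hb : 2 * Im w ^+ 2 < (Num.bound (2 * Im w ^+ 2))%:R.
  by apply: archi_boundP; rewrite mulr_ge0 ?sqr_ge0.
apply: Gamma_neq0_large; rewrite /n -[(Num.bound _).+1%:R]natr1.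
- by rewrite addrA ltrDr addr_gt0// (le_lt_trans _ hb)// mulr_ge0 ?sqr_ge0.
- by rewrite addrA addrK (lt_trans hb)// ltrDr.
Qed.

End gamma.

(** * The Mellin-Barnes formula *)

Section mellin_barnes.
Context {R : realType}.
Local Notation mu := (@lebesgue_measure R).
Implicit Types (a b c u x y : R) (w : R[i]).

(** Translation by [L] in the logarithmic variable rescales the Euler integral by [e^L]; it is used
    with [e^L = 1 + X]. *)
Lemma Gamma_shift a b (L : R) : 0 < a -> Gamma (a +i* b) =
  cintegral setT (fun u => phase (b * (L + u)) * (eul a (L + u))%:C).
Proof.
move=> a0; rewrite GammaRe//.
have i1 := rintegrable_eul_trig a0 (@continuous_cosM R b) (fun _ => cos_max _).
have i2 := rintegrable_eul_trig a0 (@continuous_sinM R b) (fun _ => sin_max _).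
have c1 : continuous (fun u => eul a u * cos (b * u)).
  by move=> u; apply: cvgM; [exact: continuous_eul|exact: continuous_cosM].
have c2 : continuous (fun u => eul a u * sin (b * u)).
  by move=> u; apply: cvgM; [exact: continuous_eul|exact: continuous_sinM].
apply: complex_ext; rewrite [LHS]/=.
- rewrite -(Rintegral_shift L c1 i1).2 Re_cintegral.
  by apply: eq_Rintegral => u _; rewrite Re_phase_real.
- rewrite -(Rintegral_shift L c2 i2).2 Im_cintegral.
  by apply: eq_Rintegral => u _; rewrite Im_phase_real.
Qed.

(** [Gamma (a - iy)] is the Fourier transform of [eul a], integrable in [y] since [a >= 1]. In the
    variable [X = e^x] this is the inverse Mellin transform giving [e^(-X)]. *)
Lemma Gamma_inversion a x : 1 <= a ->
  cintegral setT (fun y => phase (x * y) * Gamma (a +i* - y)) =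
  (2 * pi * eul a x)%:C.
Proof.
move=> a1; have a0 : 0 < a by rewrite (lt_le_trans ltr01).
have [M hM] := eul_bounded a0.
apply: (@fourier_inversion _ (eul a) M) => //.
- exact: continuous_eul.
- exact: rintegrable_eul.
- move=> y; rewrite GammaE//; congr cintegral; apply/funext => u.
  by rewrite mulNr.
- exact: cintegrable_Gamma.
Qed.

Lemma cexp_phase a b x : cexp ((a +i* b) * x%:C) = (expR (a * x))%:C * phase (b * x).
Proof.
rewrite phaseE /cexp; congr ((expR _)%:C * (cos _ +i* sin _)).
- by rewrite ReM /= mulr0 subr0.
- by rewrite ImM /= mulr0 add0r.
- by rewrite ImM /= mulr0 add0r.
Qed.

Lemma cmeasurable_Gamma_prod (sigma t c : R) : - sigma < c -> c <= -1 ->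
  cmeasurable (fun y => Gamma (sigma +i* t + c +i* y) * Gamma (- (c +i* y))).
Proof.
move=> sc c1.
have sc0 : 0 < sigma + c by lra.
have c0 : 0 < - c by lra.
have [r1 i1] := cmeasurable_Gamma sc0; have [r2 i2] := cmeasurable_Gamma c0.
have mt : measurable_fun setT (fun y : R => t + y) by exact: measurable_funD.
have mN : measurable_fun setT (@GRing.opp R) by exact: oppr_measurable.
apply: cmeasurableM; split.
- exact: (measurableT_comp r1 mt).
- exact: (measurableT_comp i1 mt).
- exact: (measurableT_comp r2 mN).
- exact: (measurableT_comp i2 mN).
Qed.

(** [Gamma (s + z)] is only bounded on the line, since its real part [sigma + c] is just positive;
    the decay comes from [Gamma (- z)], whose real part [- c] is at least 1. *)
Lemma normc_Gamma_prod_le (sigma t c : R) : - sigma < c -> c <= -1 ->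
  exists C, forall y,
    normc (Gamma (sigma +i* t + c +i* y) * Gamma (- (c +i* y))) <=
    C * (oneDsqr y)^-1.
Proof.
move=> sc c1.
have sc0 : 0 < sigma + c by lra.
have c0 : 1 <= - c by lra.
exists (2 * eulint (sigma + c) * (2 * eulint (- c + 2))) => y.
rewrite normcM -[leRHS]mulrA ler_pM ?normc_ge0//.
- exact: (@normc_Gamma_le _ ((sigma + c) +i* (t + y)) sc0).
- have := normc_Gamma_decay (- y) c0.
  by rewrite (_ : oneDsqr (- y) = oneDsqr y)// /oneDsqr sqrrN.
Qed.

Lemma mellin_barnes_integrable (sigma t c x : R) : - sigma < c -> c <= -1 ->
  cintegrable setT (fun y => Gamma (sigma +i* t + c +i* y) * Gamma (- (c +i* y)) *
    cexp ((c +i* y) * x%:C)).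
Proof.
move=> sc c1; have [C hC] := normc_Gamma_prod_le t sc c1.
apply: (@dominated_cintegrable _ _ (fun y => C * expR (c * x) * (oneDsqr y)^-1)).
- apply: cmeasurableM; first exact: cmeasurable_Gamma_prod.
  apply: cmeasurable_cexp; apply: cmeasurableM; last exact: cmeasurable_cst.
  exact: cmeasurable_pair.
- move=> y; rewrite normcM mulrAC ler_pM ?normc_ge0//.
  by rewrite normc_cexp ReM /= mulr0 subr0.
- by apply: rintegrableZ; exact: rintegrable_oneDsqrV.
Qed.

(* [x] stands for the logarithm of the variable [X] of the Mellin transform. *)
Lemma mellin_barnes (sigma t c x : R) : - sigma < c -> c <= -1 ->
  cintegral setT (fun y => Gamma (sigma +i* t + c +i* y) * Gamma (- (c +i* y)) *
    cexp ((c +i* y) * x%:C)) =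
  (2 * pi)%:C * Gamma (sigma +i* t) *
    cexp (- (sigma +i* t) * (ln (1 + expR x))%:C).
Proof.
move=> sc c1.
have s0 : 0 < sigma by lra.
have sc0 : 0 < sigma + c by lra.
have c0 : 1 <= - c by lra.
(* [f] is [Gamma (- z) X^z]; [g] is the Euler integrand of [Gamma (s + c)], from which the factor
   [phase (y * u)] produces [Gamma (s + z)]. *)
pose f y := (expR (c * x))%:C * (phase (x * y) * Gamma (- c +i* - y)).
pose g u := phase (t * u) * (eul (sigma + c) u)%:C.
have if_ : cintegrable setT f.
  apply: cintegrableZ; have ig := cintegrable_Gamma c0.
  apply: (dominated_cintegrable _ _ (rintegrable_normc ig)).
    apply: cmeasurableM; last exact: cintegrable_cmeasurable.
    by apply: cmeasurable_phase; apply: measurable_funM.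
  by move=> y; rewrite normcM normc_phase mul1r normc_le.
have ig : cintegrable setT g by exact: cintegrable_eul.
transitivity (cintegral setT (fun y => f y * cintegral setT (fun u =>
    phase (y * u) * g u))).
  congr cintegral; apply/funext => y.
  rewrite (_ : _ + _ = (sigma + c) +i* (t + y)); last first.
    by apply: complex_ext; rewrite /= ?addr0.
  rewrite GammaE// cexp_phase /f [x * y]mulrC.
  rewrite [in RHS](_ : (fun u => phase (y * u) * g u) =
    fun u => phase ((t + y) * u) * (eul (sigma + c) u)%:C).
    rewrite (_ : - (c +i* y) = - c +i* - y)//.
    by set G := Gamma _; set I := cintegral _ _; set e := real_complex _ _; ring.
  by apply/funext => u; rewrite /g mulrA -phaseD; congr (phase _ * _); ring.
rewrite fourier_exchange//; last 2 first.
- by apply: cmeasurable_phase; apply: measurable_funM;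
    [exact: measurable_fst|exact: measurable_snd].
- by move=> y u; rewrite normc_phase.
pose L := ln (1 + expR x).
have eL : expR L = 1 + expR x.
  by rewrite /L lnK// posrE addr_gt0 ?expR_gt0.
rewrite -mulrA [Gamma _ * _]mulrC (Gamma_shift t L s0) mulrA -cintegralZ.
  congr cintegral; apply/funext => u.
  (* Inversion at [x + u]: the inner integral is [2 * pi * e^(-c u)] times the exponential of
     [- X e^u]. *)
  have -> : cintegral setT (fun y => f y * phase (y * u)) =
      (expR (c * x) * (2 * pi * eul (- c) (x + u)))%:C.
    rewrite complexrM -Gamma_inversion// -cintegralZ; last first.
      have ig' := cintegrable_Gamma c0.
      apply: (dominated_cintegrable _ _ (rintegrable_normc ig')).
        apply: cmeasurableM; last exact: cintegrable_cmeasurable.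
        by apply: cmeasurable_phase; apply: measurable_funM.
      by move=> y; rewrite normcM normc_phase mul1r normc_le.
    congr cintegral; apply/funext => y.
    rewrite /f mulrDl phaseD [u * y]mulrC.
    by set G := Gamma _; set e := real_complex _ _; ring.
  have -> : cexp (- (sigma +i* t) * L%:C) =
      (expR (- sigma * L))%:C * phase (- t * L) by exact: (cexp_phase (- sigma) (- t)).
  rewrite /g.
  have -> : phase (t * u) = phase (- t * L) * phase (t * (L + u)).
    by rewrite -phaseD; congr phase; ring.
  have -> : (expR (c * x) * (2 * pi * eul (- c) (x + u)))%:C *
      (phase (- t * L) * phase (t * (L + u)) * (eul (sigma + c) u)%:C) =
      ((2 * pi) * (expR (c * x) * eul (- c) (x + u) * eul (sigma + c) u))%:C *
      (phase (- t * L) * phase (t * (L + u))).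
    by rewrite !complexrM; ring.
  (* The two inner exponentials combine: [e^u + e^(x + u) = (1 + X) e^u = e^(L + u)]; the powers
     involving [c] cancel. *)
  have -> : expR (c * x) * eul (- c) (x + u) * eul (sigma + c) u =
      expR (- sigma * L) * eul sigma (L + u).
    rewrite /eul -!expRD; congr expR; rewrite expRD [expR (L + u)]expRD eL.
    by ring.
  by rewrite !complexrM; ring.
apply: (@dominated_cintegrable _ _ (fun u => eul sigma (L + u))).
- apply: cmeasurableM.
    apply: cmeasurable_phase; apply: measurable_funM => //.
    exact: measurable_funD.
  apply: cmeasurable_real; apply: continuous_measurable_fun => u.
  apply: (@continuous_comp _ _ _ (fun u : R => L + u) (eul sigma)).
    by apply: cvgD; [exact: cvg_cst|exact: cvg_id].
  exact: continuous_eul.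
- by move=> u; rewrite normcM normc_phase mul1r normc_real ger0_norm ?eul_ge0.
- have := Rintegral_shift L (@continuous_eul R sigma) (rintegrable_eul s0).
  by case.
Qed.

End mellin_barnes.

(** * Dirichlet series *)

Section dirichlet_series.
Context {R : realType}.
Implicit Types (p alpha x y : R) (w z : R[i]).

(** From [x + 1 <= 2 x] comes [x^(-p) <= 2^p (x + 1)^(-p)]; then [ln ((x + 1) / x) >= 1 / (x + 1)]
    bounds [(p - 1) (x + 1)^(-p)] by the difference [x^(1-p) - (x + 1)^(1-p)]. *)
Lemma telescoping_majorant p x : 1 < p -> 1 <= x ->
  expR (- p * ln x) <= 2 `^ p / (p - 1) *
    (expR (- (p - 1) * ln x) - expR (- (p - 1) * ln (x + 1))).
Proof.
move=> p1 x1; have x0 : 0 < x by rewrite (lt_le_trans ltr01).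
have p0 : 0 < p by rewrite (lt_trans ltr01).
have d0 : 0 < p - 1 by rewrite subr_gt0.
have y0 : 0 < x + 1 by rewrite addr_gt0.
have h1 : expR (- p * ln x) <= 2 `^ p * expR (- p * ln (x + 1)).
  rewrite /powR pnatr_eq0/= -expRD ler_expR.
  have : ln (x + 1) <= ln 2 + ln x.
    by rewrite -lnM ?posrE// ler_ln ?posrE ?mulr_gt0// mulr_natl mulr2n lerD2l.
  by rewrite -(ler_pM2l p0); lra.
apply: (le_trans h1); rewrite -mulrA ler_wpM2l ?powR_ge0// ler_pdivlMl//.
have -> : - (p - 1) * ln x =
    - (p - 1) * ln (x + 1) + (p - 1) * (ln (x + 1) - ln x) by ring.
have -> : - p * ln (x + 1) = - (p - 1) * ln (x + 1) + - ln (x + 1) by ring.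
rewrite !expRD -[X in _ <= _ - X]mulr1 -mulrBr mulrCA ler_wpM2l ?expR_ge0//.
rewrite expRN lnK ?posrE// lerBrDl.
apply: le_trans (expR_ge1Dx _); rewrite lerD2l ler_wpM2l ?(ltW d0)//.
have := @le_ln1Dx R (- (x + 1)^-1).
have -> : 1 + - (x + 1)^-1 = x / (x + 1) by field; rewrite gt_eqF.
rewrite ltrN2 invf_lt1// ltrDr x0 => /(_ isT).
by rewrite ln_div ?posrE// -(lerN2 (- _)) opprB opprK.
Qed.

(* Summation starts at [k = 0] here, whence the shift. *)
Definition zpow alpha w (k : nat) : R[i] := cpow (k.+1%:R + alpha) (- w).

Lemma zpow_base_ge1 alpha k : 0 <= alpha -> 1 <= k.+1%:R + alpha.
Proof. by move=> a0; rewrite ler_wpDr// ler1n. Qed.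

Lemma normc_zpow alpha w k :
  normc (zpow alpha w k) = expR (- Re w * ln (k.+1%:R + alpha)).
Proof. by rewrite /zpow /cpow normc_cexp ReM ReN /= mulr0 subr0. Qed.

Lemma sum_normc_zpow_le alpha p : 1 < p -> 0 <= alpha ->
  exists B, forall N, \sum_(0 <= k < N) expR (- p * ln (k.+1%:R + alpha)) <= B.
Proof.
move=> p1 a0; pose C := 2 `^ p / (p - 1).
pose e k := expR (- (p - 1) * ln (k.+1%:R + alpha)).
have C0 : 0 <= C by rewrite divr_ge0 ?powR_ge0// subr_ge0 ltW.
exists (C * e 0%N) => N.
apply: (@le_trans _ _ (\sum_(0 <= k < N) C * (e k - e k.+1))).
  apply: ler_sum => k _.
  have := @telescoping_majorant p (k.+1%:R + alpha) p1 (zpow_base_ge1 k a0).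
  by rewrite addrAC natr1.
rewrite -mulr_sumr ler_wpM2l// (@telescope_sumr_eq _ 0 N (fun k => - e k))//.
  by rewrite opprK addrC gerDl oppr_le0 expR_ge0.
by move=> k _; rewrite opprK addrC.
Qed.

Lemma is_cvg_normc_zpow alpha w : 1 < Re w -> 0 <= alpha ->
  cvgn (series (fun k => normc (zpow alpha w k))).
Proof.
move=> w1 a0; have [B hB] := sum_normc_zpow_le w1 a0.
apply: nondecreasing_is_cvgn.
  by apply: nondecreasing_series => n _ _; exact: normc_ge0.
exists B => _ [n _ <-]; apply: le_trans (hB n).
by apply: ler_sum => k _; rewrite normc_zpow.
Qed.

Lemma is_cvg_csum (a : nat -> R[i]) : cvgn (series (fun k => normc (a k))) ->
  exists l, ccvg (fun N => \sum_(0 <= k < N) a k) l.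
Proof.
move=> ca.
have cr : cvgn (series (fun k => Re (a k))).
  apply: normed_cvg; apply: (series_le_cvg _ _ _ ca) => k.
  - exact: normr_ge0.
  - exact: normc_ge0.
  - exact: ler_Re_normc.
have ci : cvgn (series (fun k => Im (a k))).
  apply: normed_cvg; apply: (series_le_cvg _ _ _ ca) => k.
  - exact: normr_ge0.
  - exact: normc_ge0.
  - exact: ler_Im_normc.
exists (limn (series (fun k => Re (a k))) +i* limn (series (fun k => Im (a k)))).
split => /=.
- by under eq_fun do rewrite Re_sum; exact: cr.
- by under eq_fun do rewrite Im_sum; exact: ci.
Qed.

Lemma ccvg_limn (u : nat -> R[i]) l : ccvg u l -> limn (u : nat -> R[i]^o) = l.
Proof.
move=> [ur ui]; apply/cvg_lim; first exact: norm_hausdorff.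
(* A positive element of [R[i]] is real; each component gets half of it. *)
apply/cvgrPdist_lt => e; case: e => er ei; rewrite ltcE /= => /andP[/eqP -> e0].
have e20 : 0 < er / 2 by rewrite divr_gt0.
move/cvgrPdist_lt/(_ _ e20) : ur => ur; move/cvgrPdist_lt/(_ _ e20) : ui => ui.
near=> n.
have h : normc (l - u n) < er.
  rewrite (le_lt_trans (normc_le _))// ReD ImD ReN ImN [ltRHS](splitr er) ltrD//.
  - by near: n.
  - by near: n.
by rewrite normc_def ltcE /= eqxx /=; case: (l - u n) h.
Unshelve. all: by end_near. Qed.

Lemma ccvg_pred (u : nat -> R[i]) l : ccvg u l -> ccvg (fun n => u n.-1) l.
Proof. by move=> [ur ui]; split; rewrite -cvg_shiftS. Qed.

Lemma ccvg_hurwitz1 alpha w : 1 < Re w -> 0 <= alpha ->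
  ccvg (fun N => \sum_(0 <= k < N) zpow alpha w k) (hurwitz1 w alpha).
Proof.
move=> w1 a0; rewrite /hurwitz1 /continuation ifT; last by rewrite inE.
have [l hl] := is_cvg_csum (is_cvg_normc_zpow w1 a0).
(* With [n = k + 1], the range [1 <= n < N] becomes [k < N - 1]. *)
have -> : (fun N => \sum_(1 <= n < N) (cpow (n%:R + alpha) (- w) : R[i]^o)) =
    fun N => \sum_(0 <= k < N.-1) zpow alpha w k.
  by apply/funext => N; rewrite big_add1.
by rewrite (ccvg_limn (ccvg_pred hl)).
Qed.

(** Both sides continue the same function by the same choice, so they agree at every [w]. *)
Lemma zetaE w : zeta w = hurwitz1 w 0.
Proof.
have E (z : R[i]) : (fun N => \sum_(1 <= n < N) (cpow n%:R (- z) : R[i]^o)) =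
    fun N => \sum_(1 <= n < N) (cpow (n%:R + 0) (- z) : R[i]^o).
  by apply/funext => N; apply: eq_bigr => k _; rewrite addr0.
by rewrite /zeta /hurwitz1; congr (continuation _ _ _ _); apply/funext => z; rewrite E.
Qed.

End dirichlet_series.

(** * The squared modulus of an absolutely convergent series *)

Section product_of_series.
Context {R : realType}.
Implicit Types (a : nat -> R[i]).

Lemma ccvg_normc0 (u : nat -> R[i]) (b : nat -> R) :
  (forall n, normc (u n) <= b n) -> b n @[n --> \oo] --> (0 : R) -> ccvg u 0.
Proof.
move=> ub b0; have nb0 : - b n @[n --> \oo] --> (0 : R).
  by rewrite -oppr0; exact: cvgN.
split; apply: (squeeze_cvgr _ nb0 b0); near=> n; rewrite -ler_norml.
- by rewrite (le_trans (ler_Re_normc _)).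
- by rewrite (le_trans (ler_Im_normc _)).
Unshelve. all: by end_near. Qed.

(** Splits the square of index pairs into the diagonal and two conjugate triangles; [V] sums
    [a m * conjc (a k)] over [k < m < N]. *)
Lemma sum_mul_conj a N (A := fun n => \sum_(0 <= k < n) a k) :
  let V := \sum_(0 <= k < N) conjc (a k) * (A N - A k.+1) in
  A N * conjc (A N) = \sum_(0 <= k < N) a k * conjc (a k) + V + conjc V.
Proof.
have conjD (z w : R[i]) : conjc (z + w) = conjc z + conjc w by exact: rmorphD.
have conjB (z w : R[i]) : conjc (z - w) = conjc z - conjc w by exact: rmorphB.
have conjM (z w : R[i]) : conjc (z * w) = conjc z * conjc w by exact: rmorphM.
have conjS (I : Type) (r : seq I) (F : I -> R[i]) :
  conjc (\sum_(i <- r) F i) = \sum_(i <- r) conjc (F i) by exact: rmorph_sum.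
elim: N => [|N] /=.
  by rewrite /A !big_geq// mul0r !add0r; apply: complex_ext; rewrite /= ?oppr0.
set V := \sum_(0 <= k < N) conjc (a k) * _ => IH.
have AS : A N.+1 = A N + a N by rewrite /A big_nat_recr.
have -> : \sum_(0 <= k < N.+1) conjc (a k) * (A N.+1 - A k.+1) = V + a N * conjc (A N).
  rewrite big_nat_recr//= subrr mulr0 addr0 AS.
  rewrite (eq_bigr (fun k => conjc (a k) * (A N - A k.+1) + a N * conjc (a k))).
    by rewrite big_split/= -mulr_sumr -conjS.
  by move=> k _; ring.
have -> : conjc (V + a N * conjc (A N)) = conjc V + conjc (a N) * A N.
  by rewrite conjD conjM conjcK.
have -> : conjc (A N.+1) = conjc (A N) + conjc (a N) by rewrite AS; exact: conjD.
rewrite big_nat_recr//= AS; move: IH.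
move: (conjc (A N)) (conjc (a N)) (\sum_(0 <= k < N) a k * _) (conjc V).
clearbody V; move: (A N) (a N) => x y x' y' D V' IH.
by rewrite mulrDl !mulrDr IH; ring.
Qed.

Lemma normc_csumB_le a m n : (m <= n)%N ->
  normc (\sum_(0 <= k < n) a k - \sum_(0 <= k < m) a k) <=
  \sum_(0 <= k < n) normc (a k) - \sum_(0 <= k < m) normc (a k).
Proof.
move=> mn.
have E (V : zmodType) (f : nat -> V) : \sum_(0 <= k < n) f k -
    \sum_(0 <= k < m) f k = \sum_(m <= k < n) f k.
  by rewrite (@big_cat_nat _ _ _ m 0 n)//= addrAC subrr add0r.
by rewrite (E R[i]) (E R); exact: normc_sum.
Qed.

(** In terms of [j = m - k - 1] the off-diagonal terms are summed over squares [j, k < N] instead of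
    triangles [k < m < N]; by absolute convergence the two sums have the same limit. *)
Lemma ccvg_norm_expansion a (A D T : R[i]) :
  cvgn (series (fun k => normc (a k))) ->
  ccvg (fun N => \sum_(0 <= k < N) a k) A ->
  ccvg (fun N => \sum_(0 <= k < N) a k * conjc (a k)) D ->
  ccvg (fun N => \sum_(0 <= j < N) \sum_(0 <= k < N) a (k + j).+1 * conjc (a k)) T ->
  A * conjc A = D + (T + conjc T).
Proof.
move=> ca cA cD cT.
pose S n := \sum_(0 <= k < n) a k; pose B n := \sum_(0 <= k < n) normc (a k).
pose U N := \sum_(0 <= j < N) \sum_(0 <= k < N) a (k + j).+1 * conjc (a k).
pose V N := \sum_(0 <= k < N) conjc (a k) * (S N - S k.+1).
(* For fixed [k], the index [m = k + j + 1] runs from [k + 1] to [k + N]. *)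
have UE N : U N = \sum_(0 <= k < N) conjc (a k) * (S (k.+1 + N)%N - S k.+1).
  rewrite /U exchange_big_nat/=; apply: eq_bigr => k _.
  rewrite -mulr_suml mulrC /S (@big_cat_nat _ _ _ k.+1 0 (k.+1 + N))//=; last first.
    exact: leq_addr.
  rewrite addrAC subrr add0r; congr (_ * _).
  rewrite -[X in _ = \sum_(X <= _ < _) _]add0n big_addn addKn.
  by apply: eq_bigr => j _; rewrite addnS addnC.
pose Btot := limn (series (fun k => normc (a k))).
have Bcv : B n @[n --> \oo] --> Btot by exact: ca.
have Bnd : nondecreasing_seq B.
  by apply: nondecreasing_series => n _ _; exact: normc_ge0.
have BB n : B n <= Btot by exact: nondecreasing_cvgn_le.
have cUV : ccvg (fun N => V N - U N) 0.
  (* For each [k] the discrepancy involves only terms of index at least [N], hence a tail of the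
     norm series. *)
  apply: (@ccvg_normc0 _ (fun N => Btot * (Btot - B N))).
    move=> N; rewrite UE /V -sumrB (le_trans (normc_sum _ _ _))//.
    apply: (@le_trans _ _ (\sum_(0 <= k < N) normc (a k) * (Btot - B N))).
      apply: ler_sum => k _.
      rewrite -mulrBr opprB addrA subrK normcM normc_conj ler_wpM2l ?normc_ge0//.
      rewrite -opprB normcN (le_trans (normc_csumB_le a _)) ?leq_addl//.
      by rewrite lerD2r; exact: BB.
    rewrite -mulr_suml ler_wpM2r ?subr_ge0//; exact: BB.
  rewrite -(mulr0 Btot) -(subrr Btot).
  by apply: cvgM; [exact: cvg_cst|apply: cvgB => //; exact: cvg_cst].
have cV : ccvg V T.
  rewrite (_ : V = fun N => U N + (V N - U N)); last first.
    by apply/funext => N; rewrite addrC subrK.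
  by rewrite -[T]addr0; exact: ccvgD.
apply: (ccvg_unique (ccvgM cA (ccvg_conj cA))).
rewrite addrA; have := ccvgD (ccvgD cD cV) (ccvg_conj cV).
congr ccvg; apply/funext => N; apply/esym.
exact: sum_mul_conj.
Qed.

End product_of_series.

(** * The mean value formula *)

Section mean_value_formula.
Context {R : realType}.
Implicit Types (sigma t alpha c y : R) (s w : R[i]).

Lemma zpow_conj alpha w k : zpow alpha (conjc w) k = conjc (zpow alpha w k).
Proof.
rewrite /zpow /cpow -cexp_conj; congr cexp.
by apply: complex_ext; case: w => a b /=; ring.
Qed.

Lemma zpow_sqr alpha sigma t k :
  zpow alpha (sigma +i* t) k * conjc (zpow alpha (sigma +i* t) k) =
  zpow alpha (2 * sigma)%:C k.
Proof.
rewrite -zpow_conj /zpow /cpow -cexpD; congr cexp.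
by apply: complex_ext; rewrite /=; ring.
Qed.

Lemma cmeasurable_zpow alpha (f : R -> R[i]) k : cmeasurable f ->
  cmeasurable (fun y => zpow alpha (f y) k).
Proof.
move=> [fr fi]; apply: cmeasurable_cexp; apply: cmeasurableM; last first.
  exact: cmeasurable_cst.
split.
- rewrite (_ : _ \o _ = fun y => - Re (f y)); first exact: measurable_funN.
  by apply/funext => y /=; rewrite ReN.
- rewrite (_ : _ \o _ = fun y => - Im (f y)); first exact: measurable_funN.
  by apply/funext => y /=; rewrite ImN.
Qed.

(** One bound for all partial sums on the whole line [Re w = p], as domination under the line
    integral requires. *)
Lemma normc_sum_zpow_le alpha p : 1 < p -> 0 <= alpha ->
  exists2 B, 0 <= B & forall w N, Re w = p ->
    normc (\sum_(0 <= k < N) zpow alpha w k) <= B.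
Proof.
move=> p1 a0; have [B hB] := sum_normc_zpow_le p1 a0.
exists B; first by have := hB 0%N; rewrite big_geq.
move=> w N wp; apply: (le_trans (normc_sum _ _ _)); apply: le_trans (hB N).
by apply: ler_sum => k _; rewrite normc_zpow wp.
Qed.

(** The Mellin-Barnes formula at [X = (j + 1) / x] with [x = k + 1 + alpha], times [x^(-2 sigma)].
    As [x (1 + X) = k + j + 2 + alpha], the index on the right is [(k + j).+1]. *)
Lemma mellin_barnes_zpow sigma t alpha c j k : 1 < sigma -> 0 <= alpha ->
  - sigma < c -> c <= -1 ->
  let H y := Gamma (sigma +i* t + c +i* y) * Gamma (- (c +i* y)) *
    (zpow 0 (- (c +i* y)) j * zpow alpha ((2 * sigma)%:C + c +i* y) k) in
  cintegrable setT H /\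
  cintegral setT H = (2 * pi)%:C * Gamma (sigma +i* t) *
    (zpow alpha (sigma +i* t) (k + j).+1 * conjc (zpow alpha (sigma +i* t) k)).
Proof.
move=> s1 a0 sc c1 H.
pose x := k.+1%:R + alpha; pose xi := ln j.+1%:R - ln x.
have x0 : 0 < x by rewrite (lt_le_trans ltr01)// zpow_base_ge1.
have HE : H = fun y => cexp (- (2 * sigma)%:C * (ln x)%:C) *
    (Gamma (sigma +i* t + c +i* y) * Gamma (- (c +i* y)) *
     cexp ((c +i* y) * xi%:C)).
  apply/funext => y; rewrite /H [RHS]mulrCA; congr (_ * _).
  rewrite /zpow /cpow -!cexpD addr0 -/x; congr cexp.
  by apply: complex_ext; rewrite /xi /=; ring.
have iMB := mellin_barnes_integrable t xi sc c1.
rewrite HE; split; first exact: cintegrableZ.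
rewrite cintegralZ// mellin_barnes//.
have -> : ln (1 + expR xi) = ln ((k + j).+2%:R + alpha) - ln x.
  have y0 : 0 < (k + j).+2%:R + alpha by rewrite ltr_wpDr// ltr0Sn.
  rewrite -ln_div ?posrE// /xi expRB !lnK ?posrE ?ltr0Sn//.
  congr ln; rewrite (_ : (k + j).+2%:R + alpha = x + j.+1%:R).
    by rewrite mulrDl divff// gt_eqF.
  by rewrite /x [RHS]addrAC -natrD addSn addnS.
rewrite mulrCA; congr (_ * _).
rewrite -zpow_conj /zpow /cpow -!cexpD -/x; congr cexp.
by apply: complex_ext; rewrite /=; ring.
Qed.

(** The bounds [c < -1] and [1 - 2 sigma < c] give absolute convergence of the series for
    [zeta (- z)] and [hurwitz1 (2 sigma + z)] on the line; with the decay of the Gamma product,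
    dominated convergence allows termwise integration. *)
Lemma mellin_barnes_sum sigma t alpha c : 1 < sigma -> 0 <= alpha ->
  - sigma < c -> 1 - 2 * sigma < c -> c < -1 ->
  let a := zpow alpha (sigma +i* t) in
  let F y := Gamma (sigma +i* t + c +i* y) * Gamma (- (c +i* y)) *
    (zeta (- (c +i* y)) * hurwitz1 ((2 * sigma)%:C + c +i* y) alpha) in
  cintegrable setT F /\
  ccvg (fun N => \sum_(0 <= j < N) \sum_(0 <= k < N) a (k + j).+1 * conjc (a k))
    (((2 * pi)%:C * Gamma (sigma +i* t))^-1 * cintegral setT F).
Proof.
move=> s1 a0 sc sc2 c1 a F.
have c1' : c <= -1 by exact: ltW.
have s0 : 0 < sigma by rewrite (lt_trans ltr01).
pose G y := Gamma (sigma +i* t + c +i* y) * Gamma (- (c +i* y)).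
pose Z N y := \sum_(0 <= j < N) zpow 0 (- (c +i* y)) j.
pose H N y := \sum_(0 <= k < N) zpow alpha ((2 * sigma)%:C + c +i* y) k.
pose S N y := G y * (Z N y * H N y).
have reZ y : Re (- (c +i* y)) = - c by [].
have reH y : Re ((2 * sigma)%:C + c +i* y) = 2 * sigma + c by [].
have c1Z : 1 < - c by lra.
have c1H : 1 < 2 * sigma + c by lra.
have mline : cmeasurable (fun y => c +i* y) by exact: cmeasurable_pair.
have mZ N : cmeasurable (Z N).
  apply: cmeasurable_sum => j; apply: cmeasurable_zpow.
  rewrite (_ : (fun _ => _) = fun y => - c +i* - y)//.
  by apply: cmeasurable_pair => //; exact: oppr_measurable.
have mH N : cmeasurable (H N).
  apply: cmeasurable_sum => k; apply: cmeasurable_zpow.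
  by apply: cmeasurableD => //; exact: cmeasurable_cst.
have mS N : cmeasurable (S N).
  apply: cmeasurableM; first exact: cmeasurable_Gamma_prod.
  exact: cmeasurableM.
have cS y : ccvg (S ^~ y) (F y).
  apply: ccvgM; first exact: ccvg_cst.
  apply: ccvgM.
    by rewrite zetaE; apply: ccvg_hurwitz1; rewrite ?reZ.
  by apply: ccvg_hurwitz1; rewrite ?reH.
have [C hC] := normc_Gamma_prod_le t sc c1'.
have [BZ BZ0 hZ] := normc_sum_zpow_le c1Z (lexx 0).
have [BH BH0 hH] := normc_sum_zpow_le c1H a0.
have bS N y : normc (S N y) <= C * (BZ * BH) * (oneDsqr y)^-1.
  rewrite normcM mulrAC ler_pM ?normc_ge0//; first exact: hC.
  by rewrite normcM ler_pM ?normc_ge0//; [exact: hZ|exact: hH].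
have iJ : rintegrable (fun y : R => C * (BZ * BH) * (oneDsqr y)^-1).
  by apply: rintegrableZ; exact: rintegrable_oneDsqrV.
have [iF cvF] := cdominated_convergence mS cS bS iJ.
split; first exact: iF.
pose g := (2 * pi)%:C * Gamma (sigma +i* t).
have g0 : g != 0.
  rewrite mulf_neq0 ?Gamma_neq0//.
  by apply/eqP => -[/eqP]; rewrite mulf_eq0 pnatr_eq0/= gt_eqF ?pi_gt0.
have ES N : cintegral setT (S N) =
    g * \sum_(0 <= j < N) \sum_(0 <= k < N) a (k + j).+1 * conjc (a k).
  rewrite (_ : S N = fun y => \sum_(0 <= j < N) \sum_(0 <= k < N)
      G y * (zpow 0 (- (c +i* y)) j * zpow alpha ((2 * sigma)%:C + c +i* y) k)).
    rewrite cintegral_sum => [|j]; last first.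
      by apply: cintegrable_sum => k; have [] := mellin_barnes_zpow t j k s1 a0 sc c1'.
    rewrite mulr_sumr; apply: eq_bigr => j _; rewrite cintegral_sum => [|k].
      rewrite mulr_sumr; apply: eq_bigr => k _.
      by have [_] := mellin_barnes_zpow t j k s1 a0 sc c1'.
    by have [] := mellin_barnes_zpow t j k s1 a0 sc c1'.
  apply/funext => y; rewrite /S /Z mulr_suml mulr_sumr; apply: eq_bigr => j _.
  by rewrite /H mulr_sumr mulr_sumr.
have := ccvgM (ccvg_cst g^-1) cvF; congr ccvg; apply/funext => N.
by rewrite ES mulrA mulVf// mul1r.
Qed.

End mean_value_formula.

Unset Implicit Arguments.

Theorem mainTheorem1 (R : realType) (sigma t alpha c : R)
    (hsigma : 1 < sigma) (ht : 0 < t) (halpha : 0 <= alpha)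
    (hc1 : Num.max (- sigma) (1 - 2 * sigma) < c) (hc2 : c < -1) :
  let s : R[i] := sigma +i* t in
  let F (z : R[i]) : R[i] :=
    (Gamma (s + z) / Gamma s + Gamma (s^*%C + z) / Gamma s^*%C) *
    Gamma (- z) * zeta (- z) * hurwitz1 ((2 * sigma)%:C + z) alpha in
  vline_integrable c F /\
  `|hurwitz1 s alpha| ^+ 2 =
    hurwitz1 (2 * sigma)%:C alpha
    + ((2 * pi)%:C * 'i%C)^-1 * vline_integral c F.
Proof.
move=> s F.
move: hc1; rewrite gt_max => /andP[sc sc2].
have s0 : 0 < sigma by rewrite (lt_trans ltr01).
(* The two Gamma quotients in [F] correspond to [s] and its conjugate, that is, to [t] and [- t]. *)
have [i1 c1] := mellin_barnes_sum t hsigma halpha sc sc2 hc2.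
have [i2 c2] := mellin_barnes_sum (- t) hsigma halpha sc sc2 hc2.
set F1 := (fun y => _) in i1 c1; set F2 := (fun y => _) in i2 c2.
have i0 : 'i%C != 0 :> R[i] by apply/eqP => -[/eqP]; rewrite oner_eq0.
have FE : (fun y => F (c +i* y)) = fun y =>
    (Gamma s)^-1 * F1 y + (Gamma (sigma +i* - t))^-1 * F2 y.
  by apply/funext => y; rewrite /F /F1 /F2 /s; ring.
rewrite /vline_integrable /vline_integral FE; split.
  by apply: cintegrableD; exact: cintegrableZ.
rewrite cintegralD; [|exact: cintegrableZ|exact: cintegrableZ].
rewrite !cintegralZ//.
set T1 := _^-1 * _ in c1; set T2 := _^-1 * _ in c2.
(* The partial sums for [- t] are the conjugates of those for [t], so the limits are conjugate
   too. *)
have T12 : T2 = conjc T1.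
  apply: (ccvg_unique c2); have := ccvg_conj c1; congr ccvg.
  apply/funext => N; rewrite -/s.
  rewrite [LHS](rmorph_sum (@conjc R)); apply: eq_bigr => j _.
  rewrite [LHS](rmorph_sum (@conjc R)); apply: eq_bigr => k _.
  have zc m : zpow alpha (sigma +i* - t) m = conjc (zpow alpha s m) := zpow_conj alpha s m.
  by rewrite !zc; exact: (rmorphM (@conjc R)).
(* The [i] from [dz = i dy] cancels the one in [1 / (2 pi i)]. *)
have key (q x y v w : R[i]) :
    (q * 'i%C)^-1 * ('i%C * (x * v + y * w)) = q^-1 * x * v + q^-1 * y * w.
  by rewrite invfM; move: q^-1 => r; field.
rewrite key -!invfM -/T1 -/T2.
rewrite sqr_normc T12.
apply: (@ccvg_norm_expansion _ (zpow alpha s)) => //.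
- exact: is_cvg_normc_zpow.
- exact: ccvg_hurwitz1.
- under eq_fun do under eq_bigr do rewrite zpow_sqr.
  by apply: ccvg_hurwitz1 => //=; lra.
Qed.
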